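(* There is an absolute constant $C>0$ such that the following holds. Let $d=d(n)$ be natural numbers with $d\ge 10$ and $6d^3\le \log n$ (and $dn$ even). Let $G\sim\mathbb{G}_{n,d}$. Then, with probability $1-o(1)$ as $n\to\infty$, both of the following hold: the chromatic number of $G$ is strictly larger than $d/(4\log d)$, and the cohomological $k$-consistency algorithm for $\mathrm{CSP}(K_3)$ (3-colorability) accepts $G$ for every $k\le n\cdot d^{-Cd}$. Consequently, for no $k\le n\cdot d^{-Cd}$ does the cohomological $k$-consistency algorithm for $\mathrm{CSP}(K_3)$ distinguish $3$-colorable $n$-vertex graphs from $n$-vertex graphs that are not $d/(4\log d)$-colorable.
   Context: $\mathbb{G}_{n,d}$ denotes the uniform distribution over $d$-regular simple graphs on $n$ vertices. A graph $G=(V,E)$ is viewed as a relational structure with domain $V$ and one binary relation $\{(u,v),(v,u):\{u,v\}\in E\}$; $K_3$ is the complete graph on 3 vertices viewed the same way, so $G\to K_3$ (a homomorphism exists) iff $G$ is 3-colorable. Relational structures and CSPs: a signature $\sigma$ is a finite set of relation symbols with arities; a $\sigma$-structure $\mathbf{A}$ has a finite domain $A$ and relations $\Gamma^{\mathbf{A}}\subseteq A^{\mathrm{ar}(\Gamma)}$. A homomorphism $\mathbf{A}\to\mathbf{T}$ is a map $A\to T$ sending every tuple of $\Gamma^{\mathbf{A}}$ into $\Gamma^{\mathbf{T}}$ for every $\Gamma\in\sigma$. An instance of $\mathrm{CSP}(\mathbf{T})$ is a $\sigma$-structure $\mathbf{A}$ no tuple of whose relations has repeated entries. For $X\subseteq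 A$, $\mathbf{A}[X]$ is the substructure with domain $X$ whose relations consist of the tuples of $\mathbf{A}$ with all entries in $X$, and $\mathrm{Hom}(\mathbf{A}[X],\mathbf{T})$ is the set of homomorphisms $\mathbf{A}[X]\to\mathbf{T}$. Cohomological $k$-consistency: fix $\mathbf{T}$, an instance $\mathbf{A}$, and $k\ge1$. A collection $\kappa=\{\kappa(X): X\subseteq A,|X|\le k\}$ with $\kappa(X)\subseteq\mathrm{Hom}(\mathbf{A}[X],\mathbf{T})$ is $k$-consistent if for all $Y\subseteq X\subseteq A$ with $|X|\le k$: (extendability) every $\varphi\in\kappa(Y)$ is the restriction to $Y$ of some $\psi\in\kappa(X)$; (down-closure) for every $\psi\in\kappa(X)$, its restriction $\psi|_Y$ lies in $\kappa(Y)$. Every such collection contains a unique maximal $k$-consistent subcollection. For such $\kappa$, $L_k(\mathbf{A},\mathbf{T},\kappa)$ is the system of linear equations in variables $x_{X,\varphi}$ ($|X|\le k$, $\varphi\in\mathrm{Hom}(\mathbf{A}[X],\mathbf{T})$): $\sum_{\varphi\in\kappa(X)}x_{X,\varphi}=1$ for every $X$ with $|X|\le k$, and $\sum_{\varphi\in\kappa(X),\,\varphi|_Y=\psi}x_{X,\varphi}=x_{Y,\psi}$ for all $Y\subseteq X$, $|X|\le k$, $\psi\in\kappa(Y)$. The cohomological $k$-consistency algorithm for $\mathrm{CSP}(\mathbf{T})$ on input $\mathbf{A}$: initialize $\mathcal{H}(X)=\mathrm{Hom}(\mathbf{A}[X],\mathbf{T})$ for all $|X|\le k$; repeat until $\mathcal{H}$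 no longer changes: (a) replace $\mathcal{H}$ by its maximal $k$-consistent subcollection; (b) for each $X$ with $|X|\le k$ and each $\varphi\in\mathcal{H}(X)$, if $L_k(\mathbf{A},\mathbf{T},\mathcal{H})$ has no solution over $\mathbb{Z}$ with $x_{X,\varphi}=1$ and $x_{X,\psi}=0$ for all $\psi\in\mathcal{H}(X)\setminus\{\varphi\}$, then remove $\varphi$ from $\mathcal{H}(X)$ for the next iteration. Finally, reject if $\mathcal{H}(X)=\emptyset$ for some $X$, and accept otherwise. *)

(* Defs.v *)
From Stdlib Require Import Reals ZArith ClassicalEpsilon.
From mathcomp Require Import all_boot.

Set Implicit Arguments.
Unset Strict Implicit.
Unset Printing Implicit Defensive.

Definition decP (P : Prop) : bool :=
  if excluded_middle_informative P then true else false.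

Section Graphs.
Variable n : nat.

(* A (loopless, directed-pair) binary relation on the vertex set 'I_n.
   A simple graph G=(V,E) is encoded as the symmetric irreflexive relation
   {(u,v),(v,u) : {u,v} in E}, exactly as in the paper. *)
Definition graphT := {set ('I_n * 'I_n)}.

Definition simpleb (E : graphT) : bool :=
  [forall u, forall v, ((u, v) \in E) ==> ((v, u) \in E)] &&
  [forall u, (u, u) \notin E].

Definition regularb (d : nat) (E : graphT) : bool :=
  [forall u, #|[set v | (u, v) \in E]| == d].

Definition regular_graphs (d : nat) : {set graphT} :=
  [set E : graphT | simpleb E && regularb d E].

Definition prob (d : nat) (P : graphT -> Prop) : R :=
  Rdiv (INR #|[set E in regular_graphs d | decP (P E)]|)
       (INR #|regular_graphs d|).

Definition colorableb (E : graphT) (c : nat) : bool :=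
  [exists f : {ffun 'I_n -> 'I_c},
     [forall u, forall v, ((u, v) \in E) ==> (f u != f v)]].

(* chromatic number: least c such that E is c-colourable
   (defaults to 0 if no colouring exists, which never happens for simple graphs) *)
Definition chromatic_number (E : graphT) : nat :=
  match excluded_middle_informative (exists c, colorableb E c) with
  | left H => ex_minn H
  | right _ => 0
  end.

(* partial maps V -> {0,1,2}; a homomorphism A[X] -> K_3 is a partial map
   with domain exactly X that is proper on the edges inside X *)
Definition pmap := {ffun 'I_n -> option 'I_3}.

Definition dom (phi : pmap) : {set 'I_n} := [set v | phi v != None].

Definition homb (E : graphT) (X : {set 'I_n}) (phi : pmap) : bool :=
  (dom phi == X) &&
  [forall u, forall v,
     [&& u \in X, v \in X & (u, v) \in E] ==> (phi u != phi v)].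

Definition Hom (E : graphT) (X : {set 'I_n}) : {set pmap} :=
  [set phi | homb E X phi].

Definition restr (Y : {set 'I_n}) (phi : pmap) : pmap :=
  [ffun v => if v \in Y then phi v else None].

(* a collection kappa = { kappa(X) }; only the X with |X| <= k are relevant *)
Definition coll := {ffun {set 'I_n} -> {set pmap}}.

Definition consistentb (k : nat) (E : graphT) (kap : coll) : bool :=
  [forall X : {set 'I_n}, (#|X| <= k) ==>
     ((kap X \subset Hom E X) &&
      [forall Y : {set 'I_n}, (Y \subset X) ==>
         ([forall psi in kap Y, [exists phi in kap X, restr Y phi == psi]] &&
          [forall phi in kap X, restr Y phi \in kap Y])])].

Definition subcollb (kap' kap : coll) : bool :=
  [forall X, kap' X \subset kap X].

(* the (unique) maximal k-consistent subcollection = union of all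
   k-consistent subcollections *)
Definition maxsub (k : nat) (E : graphT) (kap : coll) : coll :=
  [ffun X : {set 'I_n} => [set phi | [exists kap' : coll,
      [&& consistentb k E kap', subcollb kap' kap & phi \in kap' X]]]].

Definition Lsolvable (k : nat) (E : graphT) (H : coll)
    (X0 : {set 'I_n}) (phi0 : pmap) : Prop :=
  exists x : {set 'I_n} -> pmap -> Z,
    (forall X : {set 'I_n}, #|X| <= k ->
        \big[Z.add/0%Z]_(phi in H X) x X phi = 1%Z) /\
    (forall X Y : {set 'I_n}, #|X| <= k -> Y \subset X ->
       forall psi, psi \in H Y ->
        \big[Z.add/0%Z]_(phi in H X | restr Y phi == psi) x X phi = x Y psi) /\
    x X0 phi0 = 1%Z /\
    (forall psi, psi \in H X0 -> psi != phi0 -> x X0 psi = 0%Z).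

Definition alg_step (k : nat) (E : graphT) (H : coll) : coll :=
  let H1 := maxsub k E H in
  [ffun X : {set 'I_n} => [set phi in H1 X |
                (#|X| <= k) ==> decP (Lsolvable k E H1 X phi)]].

Definition alg_init (k : nat) (E : graphT) : coll :=
  [ffun X : {set 'I_n} => if #|X| <= k then Hom E X else set0].

(* alg_step is decreasing, so after #|{set 'I_n} * pmap| rounds the
   collection no longer changes: this is "repeat until H no longer changes" *)
Definition alg_final (k : nat) (E : graphT) : coll :=
  iter #|{: {set 'I_n} * pmap}| (alg_step k E) (alg_init k E).

Definition accepts (k : nat) (E : graphT) : bool :=
  [forall X : {set 'I_n}, (#|X| <= k) ==> (alg_final k E X != set0)].

End Graphs.

Local Open Scope R_scope.

Definition chi_threshold (d : nat) : R := (INR d / (4 * ln (INR d))).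

Definition kbound (C : R) (n d : nat) : R :=
  (INR n * Rpower (INR d) (- (C * INR d))).

Definition good_event (C : R) (n d : nat) (E : graphT n) : Prop :=
  chi_threshold d < INR (chromatic_number E) /\
  (forall k : nat, (1 <= k)%N -> INR k <= kbound C n d -> accepts k E).

(* Main.v *)
(** Fix a proper colouring [lab] of [G] with [d + 1] labels and call a vertex set
    closed if it is downward closed for [lab] and no small set outside it sends it too
    many edges.  Local sparsity gives two things: closures of sets of size [k] have size
    at most [k * d ^ O(d)], and a proper 3-colouring of a closed set [B] extends to every
    small [D] containing [B] in such a way that the colour of a vertex [w] of [D] outside
    [B] depends only on at most one vertex of [B], which lies below [w].  Hence the
    restriction of the extension to any other closed set [B'] depends only on the colours
    on the intersection of [B] and [B'], so that compatible integer-valued measures on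
    colourings of closed subsets of [D] can be glued by successive corrections.
    Induction on the size of [D] extends the point mass at any colouring of a closed set
    to a compatible family, which solves the integer system; the restrictions of the
    colourings of closures therefore survive every round of the algorithm.

    Local sparsity and the absence of large independent sets in random regular graphs are
    obtained by switching two edges [ab], [ce] into [ac], [be] and double counting. *)

Require Import Defs.
From Stdlib Require Import Reals ZArith ClassicalEpsilon Lra.
From mathcomp Require Import all_boot.
From mathcomp Require Import all_algebra zify ssrZ.

Set Implicit Arguments.
Unset Strict Implicit.
Unset Printing Implicit Defensive.

Local Open Scope nat_scope.

(** * Edge counts *)

(** Integer measures need no positivity, so a correction may always be subtracted; the danger is
    only that repairing the marginal on [B] spoils the one on [B']. This is why locality is
    demanded. It is met by fixing a single proper colouring [c] of [D] minus [B], independent of the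
    colouring of [B], and altering it only at vertices with a neighbour in [B]. Such a vertex can be
    recoloured when its neighbours outside [B] share one colour, and the ratio 6/5 in [strong] is
    what makes such a [c] exist. The closure has to absorb descending paths of up to [d] steps, so
    the number of edges per vertex allowed by sparsity must be within O(1/d) of 1. In a random
    regular graph the expected number of sets of size s with an excess of s/q edges is about (s
    d^O(q) / n)^(s/q), which is small only for s below n d^(-O(q)). Taking q of order d is the
    origin of the bound n d^(-Cd). *)

Lemma set_ind (T : finType) (P : {set T} -> Prop) : P set0 ->
  (forall x (S : {set T}), x \notin S -> P S -> P (x |: S)) -> forall S, P S.
Proof.
move=> P0 PS S; have [m] := ubnP #|S|; elim: m S => // m IH S.
have [-> //|[x xS] lt] := set_0Vmem S.
rewrite -(setD1K xS); apply: PS; rewrite ?setD11 //; apply: IH.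
by move: lt; rewrite (cardsD1 x) xS.
Qed.

Lemma subset_of_card (T : finType) (A : {set T}) m : m <= #|A| ->
  exists2 B : {set T}, B \subset A & #|B| = m.
Proof.
elim: m => [|m IH] lt; first by exists set0; rewrite ?sub0set ?cards0.
have [B sB cB] := IH (ltnW lt).
have [x xA xB] : exists2 x, x \in A & x \notin B.
  by apply/subsetPn; apply: contraL lt => sA; rewrite -leqNgt -cB subset_leq_card.
by exists (x |: B); [rewrite subUset sub1set xA | rewrite cardsU1 xB cB].
Qed.

Section EdgeCounts.
Variables (n : nat) (E : graphT n).
Hypothesis simpleE : simpleb E.

Definition adj (u v : 'I_n) := (u, v) \in E.

Lemma adjC u v : adj u v = adj v u.
Proof.
case/andP: simpleE => /forallP sE _; rewrite /adj.
by apply/idP/idP => h; [have /forallP/(_ v) := sE u | have /forallP/(_ u) := sE v]; rewrite h.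
Qed.

Lemma adjxx u : adj u u = false.
Proof. by case/andP: simpleE => _ /forallP/(_ u)/negbTE. Qed.

Lemma adj_neq u v : adj u v -> u != v.
Proof. by apply: contraTneq => ->; rewrite adjxx. Qed.

Definition inner (S : {set 'I_n}) := \sum_(u in S) \sum_(v in S) (adj u v && (u < v)).

Definition cross (S T : {set 'I_n}) := \sum_(u in S) \sum_(v in T) adj u v.

Lemma big_setU_disj (S T : {set 'I_n}) (F : 'I_n -> nat) : [disjoint S & T] ->
  \sum_(u in S :|: T) F u = \sum_(u in S) F u + \sum_(u in T) F u.
Proof. by move=> dST; rewrite -bigU //; apply: eq_bigl => u; rewrite !inE. Qed.

Lemma adj_split u v : (adj u v : nat) = (adj u v && (u < v)) + (adj v u && (v < u)).
Proof.
rewrite (adjC v u); case a: (adj u v) => //=.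
have nuv : u != v by exact: (adj_neq a).
by case: ltngtP => // /val_inj euv; rewrite euv eqxx in nuv.
Qed.

Lemma innerU (S T : {set 'I_n}) : [disjoint S & T] ->
  inner (S :|: T) = inner S + inner T + cross S T.
Proof.
move=> dST; rewrite /inner big_setU_disj //.
under eq_bigr do rewrite big_setU_disj //.
under [X in _ + X]eq_bigr do rewrite big_setU_disj //.
rewrite !big_split /= [\sum_(u in T) \sum_(v in S) _]exchange_big /=.
rewrite /cross; under [\sum_(u in S) \sum_(v in T) adj u v]eq_bigr do
  under eq_bigr do rewrite adj_split.
under [X in _ = _ + X]eq_bigr do rewrite big_split /=.
rewrite big_split /=; lia.
Qed.

Lemma crossC S T : cross S T = cross T S.
Proof.
rewrite /cross exchange_big /=.
by apply: eq_bigr => u _; apply: eq_bigr => v _; rewrite adjC.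
Qed.

Lemma sub_sum (S T : {set 'I_n}) (F : 'I_n -> nat) : S \subset T ->
  \sum_(u in S) F u <= \sum_(u in T) F u.
Proof.
move=> sST; rewrite [X in _ <= X](big_setID S) /= (setIidPr sST).
exact: leq_addr.
Qed.

Lemma cross_subr (S T T' : {set 'I_n}) : T \subset T' -> cross S T <= cross S T'.
Proof. by move=> sT; apply: leq_sum => u _; apply: sub_sum. Qed.

Lemma cross_subl (S S' T : {set 'I_n}) : S \subset S' -> cross S T <= cross S' T.
Proof. by move=> sS; rewrite /cross; apply: sub_sum. Qed.

Lemma crossUl (S S' T : {set 'I_n}) : [disjoint S & S'] -> cross (S :|: S') T = cross S T + cross S' T.
Proof. by move=> dS; rewrite /cross big_setU_disj. Qed.

Lemma crossUr (S T T' : {set 'I_n}) : [disjoint T & T'] -> cross S (T :|: T') = cross S T + cross S T'.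
Proof. by move=> dT; rewrite crossC crossUl // !(crossC S). Qed.

Lemma inner1 x : inner [set x] = 0.
Proof. by rewrite /inner !big_set1 adjxx. Qed.

Lemma inner0 : inner set0 = 0.
Proof. by rewrite /inner big_set0. Qed.

Lemma cross1l x T : cross [set x] T = \sum_(v in T) adj x v.
Proof. by rewrite /cross big_set1. Qed.

Lemma cross1_gt0 x T : (0 < cross [set x] T) = [exists v in T, adj x v].
Proof.
rewrite cross1l lt0n sum_nat_eq0 negb_forall; apply: eq_existsb => v.
by rewrite negb_imply; case: (adj x v).
Qed.

Lemma cross1_le1 x (T : {set 'I_n}) u v : cross [set x] T <= 1 -> u \in T -> v \in T ->
  adj x u -> adj x v -> u = v.
Proof.
rewrite cross1l => h uT vT au av; apply/eqP; apply: contraTT h => nuv.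
rewrite (bigD1 u) //= (bigD1 v) /= ?au ?av //.
by rewrite vT eq_sym.
Qed.

Lemma handshake (S : {set 'I_n}) : \sum_(x in S) cross [set x] S = (inner S).*2.
Proof.
under eq_bigr do rewrite cross1l.
under eq_bigr do under eq_bigr do rewrite adj_split.
under eq_bigr do rewrite big_split /=.
rewrite big_split /= [X in _ + X]exchange_big /=.
by rewrite addnn.
Qed.

Lemma inner_set1U x (S : {set 'I_n}) : x \notin S -> inner (x |: S) = inner S + cross [set x] S.
Proof.
move=> xS; rewrite innerU ?inner1 // disjoints_subset sub1set inE.
exact: xS.
Qed.

End EdgeCounts.

(** * Closed sets *)

Section Labels.
Variables (n d : nat) (E : graphT n).
Hypothesis simpleE : simpleb E.
Hypothesis degE : forall u, #|[set v | adj E u v]| <= d.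

Lemma greedy_labels : exists lab : 'I_n -> 'I_d.+1,
  forall u v, adj E u v -> lab u != lab v.
Proof.
suff [lab h] : exists lab : 'I_n -> 'I_d.+1, forall u v,
    u \in [set: 'I_n] -> v \in [set: 'I_n] -> adj E u v -> lab u != lab v.
  by exists lab => u v; apply: h; rewrite inE.
elim/set_ind: [set: 'I_n] => [|x S xS [lab h]].
  by exists (fun _ => ord0) => u v; rewrite inE.
have [c hc] : exists c, c \notin [set lab v | v in [set v | adj E x v]].
  apply/existsP; rewrite -negb_forall; apply/negP => /forallP hall.
  have : #|[set: 'I_d.+1]| <= #|[set lab v | v in [set v | adj E x v]]|.
    by apply: subset_leq_card; apply/subsetP => c _; apply: hall.
  rewrite cardsT card_ord leqNgt ltnS.
  by rewrite (leq_trans (leq_imset_card _ _) (degE x)).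
exists (fun v => if v == x then c else lab v) => u v.
rewrite !inE; case: (eqVneq u x) => [->|nux] /=; case: (eqVneq v x) => [->|nvx] /=.
- by rewrite adjxx.
- by move=> _ _ a; apply: contraNneq hc => ->; apply: imset_f; rewrite inE.
- by move=> _ _; rewrite (adjC simpleE) => a; apply: contraNneq hc => <-; apply: imset_f; rewrite inE.
- exact: h.
Qed.

End Labels.

Section Closure.
Variables (n d : nat) (E : graphT n) (lab : 'I_n -> 'I_d.+1) (s1 : nat).
Hypothesis simpleE : simpleb E.
Hypothesis degE : forall u, #|[set v | adj E u v]| <= d.
Hypothesis labE : forall u v, adj E u v -> lab u != lab v.
Implicit Types A B D S T X P Q Y W : {set 'I_n}.

Definition below (w u : 'I_n) := adj E w u && (lab u < lab w).

(** For [T] disjoint from [D] this says that [T] spans and sends into [D] at most 6/5 |T| edges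
    altogether; a single vertex outside [D] thus has at most one neighbour in [D]. *)
Definition strong (D : {set 'I_n}) :=
  [forall T : {set 'I_n}, [disjoint T & D] && (#|T| <= s1) ==>
     (5 * inner E (D :|: T) <= 5 * inner E D + 6 * #|T|)].

Definition downclosed (D : {set 'I_n}) :=
  [forall w in D, forall u, below w u ==> (u \in D)].

Definition closedb D := downclosed D && strong D.

Lemma downclosedP D : reflect (forall w u, w \in D -> below w u -> u \in D) (downclosed D).
Proof.
apply: (iffP 'forall_in_forallP) => [h w u wD b|h w wD u].
  by have := h w wD u; rewrite b.
by apply/implyP; apply: h.
Qed.

Lemma strongP D : reflect (forall T : {set 'I_n}, [disjoint T & D] -> #|T| <= s1 ->
   5 * (inner E T + cross E T D) <= 6 * #|T|) (strong D).
Proof.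
apply: (iffP forallP) => [h T dT cT|h T].
  have := h T; rewrite dT cT /= setUC innerU //; lia.
apply/implyP => /andP[dT cT]; have := h T dT cT; rewrite setUC innerU //; lia.
Qed.

Lemma closedT : closedb setT.
Proof.
apply/andP; split; first by apply/downclosedP => w u _ _; rewrite inE.
apply/strongP => T; rewrite disjoints_subset setCT subset0 => /eqP -> _.
by rewrite inner0 /cross big_set0.
Qed.

(** Split [T] by [D1]. The part outside [D1] is tested against [D1], which contains both the rest of
    [T] and the intersection; the part inside [D1] is disjoint from [D2] and is tested there. The
    two bounds add up to the bound for [T]. *)
Lemma closedI D1 D2 : closedb D1 -> closedb D2 -> closedb (D1 :&: D2).
Proof.
case/andP=> /downclosedP d1 /strongP t1 /andP[/downclosedP d2 /strongP t2].
apply/andP; split.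
  by apply/downclosedP => w u; rewrite !inE => /andP[w1 w2] b; rewrite (d1 w) // (d2 w).
apply/strongP => T dT cT.
pose T1 := T :\: D1; pose T2 := T :&: D1.
have eT : T = T1 :|: T2 by rewrite setUC setID.
have dT12 : [disjoint T1 & T2].
  by rewrite -setI_eq0; apply/eqP/setP => x; rewrite !inE; case: (x \in D1); rewrite ?andbF.
have cT12 : #|T| = #|T1| + #|T2| by rewrite addnC cardsID.
have dT1 : [disjoint T1 & D1].
  by rewrite -setI_eq0; apply/eqP/setP => x; rewrite !inE; case: (x \in D1); rewrite ?andbF.
have dT2 : [disjoint T2 & D2].
  rewrite -setI_eq0 -subset0 -setIA; move: dT; rewrite -setI_eq0 => /eqP ->.
  exact: subxx.
have h1 := t1 T1 dT1 (leq_trans (subset_leq_card (subsetDl _ _)) cT).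
have h2 := t2 T2 dT2 (leq_trans (subset_leq_card (subsetIl _ _)) cT).
rewrite cT12 {1 2}eT innerU // crossUl //.
have k1 : cross E T1 T2 + cross E T1 (D1 :&: D2) <= cross E T1 D1.
  rewrite -crossUr //; first by apply: cross_subr; rewrite subUset subsetIr subsetIl.
  by apply: disjointWl dT; apply: subsetIl.
have k2 : cross E T2 (D1 :&: D2) <= cross E T2 D2 by apply: cross_subr; apply: subsetIr.
lia.
Qed.

Definition cl (X : {set 'I_n}) := \bigcap_(D : {set 'I_n} | closedb D && (X \subset D)) D.

Lemma closed_cl X : closedb (cl X).
Proof. by apply: (big_ind (fun D => closedb D)) => [|D1 D2|D /andP[]//]; [exact: closedT | exact: closedI]. Qed.

Lemma sub_cl X : X \subset cl X.
Proof. by apply/bigcapsP => D /andP[]. Qed.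

Lemma cl_min X D : closedb D -> X \subset D -> cl X \subset D.
Proof. by move=> cD sX; apply: bigcap_inf; rewrite cD. Qed.

Lemma cl_mono X Y : X \subset Y -> cl X \subset cl Y.
Proof. by move=> sXY; exact: (cl_min (closed_cl Y) (subset_trans sXY (sub_cl Y))). Qed.

Definition lower (S : {set 'I_n}) := S :|: [set u | [exists w in S, below w u]].

Lemma sub_lower S : S \subset lower S. Proof. exact: subsetUl. Qed.

Lemma sub_iter_lower i S : S \subset iter i lower S.
Proof. by elim: i => //= i IH; apply: subset_trans IH (sub_lower _). Qed.

(** Labels drop strictly along a descent, so a late arrival has a small label; with labels at most
    [d], nothing new appears after [d] rounds. *)
Lemma lower_new i S x : x \in iter i.+1 lower S -> x \notin iter i lower S -> lab x + i < d.
Proof.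
elim: i x => [|i IH] x.
  rewrite /= inE => /orP[->//|]; rewrite inE => /existsP[w /andP[_ /andP[_ lt]]] _.
  by have := ltn_ord (lab w); lia.
rewrite [iter _ _ _]/= inE => /orP[->//|]; rewrite inE => /existsP[w /andP[wS b]] nx.
have wn : w \notin iter i lower S.
  apply: contra nx => wi; rewrite /= inE; apply/orP; right; rewrite inE.
  by apply/existsP; exists w; rewrite wi b.
have := IH w wS wn; case/andP: b => _; lia.
Qed.

Lemma downclosed_iter S : downclosed (iter d lower S).
Proof.
apply/downclosedP => w u wS b; apply/negPn/negP => nu.
suff /lower_new/(_ nu) : u \in iter d.+1 lower S by rewrite ltnNge leq_addl.
by rewrite /= inE; apply/orP; right; rewrite inE; apply/existsP; exists w; rewrite wS b.
Qed.

Lemma card_lower S : #|lower S| <= #|S| * d.+1.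
Proof.
rewrite mulnS; apply: leq_trans (leq_card_setU _ _) _; rewrite leq_add2l.
have -> : [set u | [exists w in S, below w u]] = \bigcup_(w in S) [set u | below w u].
  apply/setP => u; rewrite inE; apply/existsP/bigcupP.
    by case=> w /andP[wS b]; exists w; rewrite ?inE.
  by case=> w wS; rewrite inE => b; exists w; rewrite wS b.
apply: (@leq_trans (\sum_(w in S) #|[set u | below w u]|)).
  elim/big_rec2: _ => [|w m A _ le]; first by rewrite cards0.
  by apply: leq_trans (leq_card_setU _ _) _; rewrite leq_add2l.
rewrite -sum_nat_const; apply: leq_sum => w _; apply: leq_trans (degE w).
by apply: subset_leq_card; apply/subsetP => u; rewrite !inE => /andP[].
Qed.

Lemma card_iter_lower i S : #|iter i lower S| <= #|S| * d.+1 ^ i.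
Proof.
elim: i => [|i IH] /=; first by rewrite expn0 muln1.
apply: leq_trans (card_lower _) _; rewrite expnSr mulnA.
exact: leq_mul.
Qed.

(** Add to [Q0] the missing vertices of a descent from [S] to [p]. Each of them is adjacent to a
    vertex already present, so the excess of edges over vertices does not drop; the last inequality
    states this without subtraction. *)
Lemma reach_one i (S Q0 : {set 'I_n}) p : S \subset Q0 -> p \in iter i lower S ->
  exists Q : {set 'I_n}, [/\ Q0 \subset Q, p \in Q, Q \subset Q0 :|: iter i lower S,
    #|Q| <= #|Q0| + i & inner E Q0 + #|Q| <= inner E Q + #|Q0|].
Proof.
move=> sSQ; elim: i p => [|i IH] p.
  by move=> pS; exists Q0; rewrite (subsetP sSQ) ?subsetUl ?addn0 // addnC.
have sub Q : Q \subset Q0 :|: iter i lower S -> Q \subset Q0 :|: iter i.+1 lower S.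
  by move=> h; apply: subset_trans h (setUS _ (sub_lower _)).
rewrite [p \in _]inE => /orP[/IH|].
  by case=> Q [h1 h2 /sub h3 h4 h5]; exists Q; split=> //; lia.
rewrite inE => /existsP[w /andP[wi b]]; have [Q [h1 h2 h3 h4 h5]] := IH w wi.
case pQ: (p \in Q).
  by exists Q; split=> //; [exact: sub | lia].
exists (p |: Q); split.
- exact: subset_trans h1 (subsetUr _ _).
- by rewrite setU11.
- rewrite subUset (sub _ h3) andbT sub1set inE; apply/orP; right.
  by rewrite /= !inE; apply/orP; right; apply/existsP; exists w; rewrite wi b.
- by rewrite cardsU1 pQ add1n addnS ltnS.
- rewrite cardsU1 pQ inner_set1U ?pQ // add1n.
  have : 0 < cross E [set p] Q.
    by rewrite cross1_gt0; apply/existsP; exists w; rewrite h2 (adjC simpleE); case/andP: b.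
  lia.
Qed.

Lemma reach_set i (S P : {set 'I_n}) : P \subset iter i lower S ->
  exists Q : {set 'I_n}, [/\ S \subset Q, P \subset Q, Q \subset iter i lower S,
    #|Q| <= #|S| + #|P| * i & inner E S + #|Q| <= inner E Q + #|S|].
Proof.
elim/set_ind: P => [|p P pP IH] sP.
  by exists S; split; rewrite ?sub0set ?cards0 ?addn0 ?sub_iter_lower // addnC.
have [Q [h1 h2 h3 h4 h5]] := IH (subset_trans (subsetUr _ _) sP).
have pS : p \in iter i lower S by rewrite (subsetP sP) // setU11.
have [Q' [k1 k2 k3 k4 k5]] := reach_one h1 pS.
exists Q'; split.
- exact: subset_trans h1 k1.
- by rewrite subUset sub1set k2 (subset_trans h2 k1).
- by apply: subset_trans k3 _; rewrite subUset h3 subxx.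
- by rewrite cardsU1 pP mulnDl mul1n; lia.
- lia.
Qed.

(** If more than 2|T| vertices of [D] are adjacent to [T], any 2|T| of them already receive 2|T|
    edges, and 5 times 2|T| exceeds 6|T|. Otherwise all of them are kept. *)
Lemma few_endpoints (T D : {set 'I_n}) : 6 * #|T| < 5 * (inner E T + cross E T D) ->
  exists P : {set 'I_n}, [/\ P \subset D, #|P| <= 2 * #|T| &
    6 * #|T| < 5 * (inner E T + cross E T P)].
Proof.
move=> big; pose N := [set p in D | 0 < cross E [set p] T].
have sND : N \subset D by apply/subsetP => p; rewrite inE => /andP[].
case: (leqP #|N| (2 * #|T|)) => cN.
  exists N; split=> //; apply: leq_trans big _; rewrite leq_mul2l leq_add2l.
  rewrite crossC // (crossC _ T) // /cross (big_setID N) /= (setIidPr sND).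
  rewrite [X in _ + X]big1 ?addn0 // => p; rewrite !inE => /andP[nN pD].
  by move: nN; rewrite pD /= -leqNgt leqn0 cross1l => /eqP.
have [P sP cP] := subset_of_card (ltnW cN).
exists P; split; rewrite ?cP ?(subset_trans sP) //.
have : #|P| <= cross E T P.
  rewrite crossC // -sum1_card; apply: leq_sum => p pP.
  by have := subsetP sP p pP; rewrite inE cross1l => /andP[].
have : 0 < #|T|.
  rewrite lt0n cards_eq0; apply: contraTneq big => ->.
  by rewrite inner0 /cross big_set0 cards0.
lia.
Qed.

End Closure.

(** * Size of the closure in a locally sparse graph *)

Section ClosureSize.
Variables (n d : nat) (E : graphT n) (lab : 'I_n -> 'I_d.+1) (s1 s0 : nat).
Hypothesis simpleE : simpleb E.
Hypothesis degE : forall u, #|[set v | adj E u v]| <= d.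
Hypothesis sparseE : forall S : {set 'I_n}, #|S| <= s0 ->
  (20 * d + 10) * inner E S <= (20 * d + 11) * #|S|.

(* [M] bounds the number of vertices spent per unit of [inner E S - #|S|]; sparsity with
   ratio [1 + 1 / (2 * M)] then bounds the total gain by [3 * #|X|]. *)
Lemma card_cl (X : {set 'I_n}) : (30 * d + 16) * #|X| + (2 * d + 1) * s1 <= s0 ->
  #|cl E lab s1 X| <= (30 * d + 16) * #|X| * d.+1 ^ d.
Proof.
(* [M] is 5(2d+1): an enlargement by a violating [T] costs at most (2d+1)|T| vertices and raises the
   excess by more than |T|/5. The factor 30d+16 is 3M+1. *)
move=> le_s0; pose M := 10 * d + 5.
pose a (S : {set 'I_n}) := inner E S + #|X| - #|S|.
pose W (S : {set 'I_n}) := [&& X \subset S, #|S| <= s0, #|S| <= inner E S + #|X| &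
  #|S| <= #|X| + M * a S].
have cX : #|X| <= s0.
  by apply: leq_trans le_s0; rewrite addnC -addnA mulnDl; lia.
have WX : W X by rewrite /W subxx cX leq_addl leq_addr.
(* Extremal choice: among sets grown from [X] at the admissible price, [S] has the largest excess
   [a], so any further profitable enlargement is contradictory. *)
have [S /and4P[sXS cS iS gS] maxS] := arg_maxnP a WX.
have aS : a S <= 3 * #|X|.
  have M0 : 0 < M by rewrite /M; lia.
  have e1 : M * inner E S + M * #|X| = M * a S + M * #|S|.
    by rewrite -!mulnDr /a; congr (_ * _); lia.
  have e2 : 2 * (M * inner E S) <= 2 * (M * #|S|) + #|S|.
    by have := sparseE cS; rewrite /M; lia.
  have e3 : #|X| <= M * #|X| by apply: leq_pmull.
  have e4 : M * (3 * #|X|) = 3 * (M * #|X|) by rewrite mulnCA.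
  by rewrite -(leq_pmul2l M0) e4; lia.
have cS' : #|S| <= (30 * d + 16) * #|X| by apply: leq_trans gS _; move: (leq_mul (leqnn M) aS); rewrite /M; lia.
pose D := iter d (lower E lab) S.
have sXD : X \subset D := subset_trans sXS (sub_iter_lower _ _ _ _).
have cD : closedb E lab s1 D.
  apply/andP; split; first exact: downclosed_iter.
  apply/(strongP _ simpleE) => T dT cT; rewrite leqNgt; apply/negP => viol.
  (* A violation of strength is turned into an enlargement of [S]: [T] itself, at most 2|T|
     endpoints [P] in [D], and descents of at most [d] steps from [S] to each of them. *)
  have [P [sP cP viol']] := few_endpoints simpleE viol.
  have [Q [h1 h2 h3 h4 h5]] := reach_set simpleE sP.
  have dTQ : [disjoint Q & T] by rewrite disjoint_sym; apply: disjointWr h3 dT.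
  have cQT : #|Q :|: T| = #|Q| + #|T|.
    by rewrite cardsU (disjoint_setI0 dTQ) cards0 subn0.
  have iQT : inner E (Q :|: T) = inner E Q + inner E T + cross E Q T by rewrite innerU.
  have cTP : cross E T P <= cross E Q T.
    by rewrite crossC //; apply: cross_subl.
  have ltT : #|T| <= 5 * (inner E T + cross E T P - #|T|) by clear -viol'; lia.
  have bPd : #|P| * d <= 2 * #|T| * d by rewrite leq_mul2r cP orbT.
  have key : #|Q :|: T| <= #|S| + (2 * d + 1) * #|T|.
    rewrite cQT; clear -h4 bPd; lia.
  have key1 : (2 * d + 1) * #|T| <= (2 * d + 1) * s1 by rewrite leq_mul2l cT orbT.
  have incr : a S < a (Q :|: T).
    rewrite /a cQT iQT; clear -viol' h5 iS cTP; lia.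
  suff /maxS/(leq_trans incr) : W (Q :|: T) by rewrite ltnn.
  apply/and4P; split.
  - exact: subset_trans sXS (subset_trans h1 (subsetUl _ _)).
  - by clear -key key1 cS' le_s0; lia.
  - by rewrite cQT iQT; clear -viol' h5 iS cTP; lia.
  have step : a S + (inner E T + cross E T P - #|T|) <= a (Q :|: T).
    rewrite /a cQT iQT; clear -viol' h5 iS cTP; lia.
  have : M * a S + (2 * d + 1) * #|T| <= M * a (Q :|: T).
    apply: leq_trans (leq_mul (leqnn M) step); rewrite mulnDr leq_add2l.
    apply: leq_trans (leq_mul (leqnn (2 * d + 1)) ltT) _.
    by rewrite /M mulnCA mulnA leq_mul2r; clear; lia.
  by clear -key gS; lia.
apply: leq_trans (subset_leq_card (cl_min cD sXD)) _.
apply: leq_trans (card_iter_lower _ degE _ _) _.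
by rewrite leq_mul2r cS' orbT.
Qed.

End ClosureSize.

(** * Extending colourings *)

Section MonoColoring.
Variables (n : nat) (E : graphT n).
Hypothesis simpleE : simpleb E.
Implicit Types S T W : {set 'I_n}.

Lemma cross1_card x S : cross E [set x] S = #|[set v in S | adj E x v]|.
Proof.
rewrite cross1l -sum1_card big_mkcond /= [RHS]big_mkcond /=.
by apply: eq_bigr => v _; rewrite inE; case: (v \in S); case: (adj E x v).
Qed.

Lemma avoid_colors (c : 'I_n -> 'I_3) S : #|S| <= 2 -> exists a, forall v, v \in S -> a != c v.
Proof.
move=> cS; have [a ha] : exists a, a \notin [set c v | v in S].
  apply/existsP; rewrite -negb_forall; apply/negP => /forallP hall.
  have : #|[set: 'I_3]| <= #|[set c v | v in S]|.
    by apply: subset_leq_card; apply/subsetP => a _; apply: hall.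
  by rewrite cardsT card_ord leqNgt ltnS (leq_trans (leq_imset_card _ _) cS).
by exists a => v vS; apply: contraNneq ha => ->; apply: imset_f.
Qed.

(** [W] marks the vertices whose colour may be changed later. A marked vertex sees at most one
    colour in [S], so besides its own colour a third one is free for it. *)
Definition mono_proper S W (c : 'I_n -> 'I_3) :=
  (forall u v, u \in S -> v \in S -> adj E u v -> c u != c v) /\
  (forall w x y, w \in W :&: S -> x \in S -> y \in S -> adj E w x -> adj E w y -> c x = c y).

Lemma mono_proper_extend S W x (c : 'I_n -> 'I_3) a : x \in S -> mono_proper (S :\ x) W c ->
  (forall v, v \in S -> adj E x v -> a != c v) ->
  (forall w y, w \in W :&: S -> y \in S -> y != x -> adj E w x -> adj E w y -> a = c y) ->
  (x \in W -> cross E [set x] S <= 1) ->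
  mono_proper S W (fun v => if v == x then a else c v).
Proof.
move=> xS [pr mo] ha hm hx; split=> [u v uS vS uv|w y z].
  case: (eqVneq u x) uv => [->|nu]; case: (eqVneq v x) => [->|nv] uv.
  - by rewrite adjxx in uv.
  - exact: ha.
  - by rewrite eq_sym; apply: ha => //; rewrite (adjC simpleE).
  - by apply: pr; rewrite // !inE ?nu ?nv.
rewrite inE => /andP[wW wS] yS zS wy wz.
case: (eqVneq w x) wW wS wy wz => [-> /hx h _ xy xz|nw wW wS wy wz].
  by rewrite (cross1_le1 h yS zS xy xz).
have wI : w \in W :&: S by rewrite inE wW.
case: (eqVneq y x) wy => [->|ny] wy; case: (eqVneq z x) wz => [->|nz] wz //.
- exact: (hm w).
- by symmetry; apply: (hm w).
- by apply: (mo w); rewrite // !inE ?nw ?ny ?nz ?wW.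
Qed.

(* A graph so sparse always has a vertex that can be coloured last: an unmarked
   vertex of degree at most 1, one of degree at most 2 without marked neighbours,
   or a marked vertex of degree at most 1. *)
Lemma mono_coloring S W :
  (forall S', S' \subset S -> 5 * (inner E S' + #|W :&: S'|) <= 6 * #|S'|) ->
  exists c, mono_proper S W c.
Proof.
have [m] := ubnP #|S|; elim: m S => // m IH S ltS sp.
(* Two adjacent marked vertices would give 5(1+2) on the left against 12 on the right. *)
have indep u v : u \in W :&: S -> v \in W :&: S -> ~~ adj E u v.
  rewrite !inE => /andP[uW uS] /andP[vW vS]; apply/negP => uv.
  have nuv : u \notin [set v] by rewrite inE (adj_neq simpleE uv).
  have := sp [set u; v]; rewrite subUset !sub1set uS vS => /(_ isT).
  rewrite (setIidPr _) ?subUset ?sub1set ?uW // cardsU1 nuv cards1.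
  by rewrite inner_set1U // inner1 // cross1l big_set1 uv.
have step x : x \in S -> exists c, mono_proper (S :\ x) W c.
  move=> xS; apply: IH => [|S' sS']; first by move: ltS; rewrite (cardsD1 x) xS.
  exact: sp (subset_trans sS' (subD1set _ _)).
pose A := W :&: S; pose B := S :\: W.
pose rem x := (x \in S) && if x \in W then cross E [set x] S <= 1 else
  (cross E [set x] S <= 1) || (cross E [set x] S <= 2) && (cross E [set x] A == 0).
have [x /andP[xS]|norem] := pickP rem.
  have [c hc] := step x xS.
  case: ifP => [xW dx|xW dx].
    have [|a ha] := @avoid_colors c [set v in S | adj E x v].
      by rewrite -cross1_card (leq_trans dx).
    exists (fun v => if v == x then a else c v); apply: mono_proper_extend => //.
      by move=> v vS xv; apply: ha; rewrite inE vS.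
    by move=> w y wI yS _ wx; have := indep w x wI; rewrite inE xW xS => /(_ isT); rewrite wx.
  have xW' : x \in W -> cross E [set x] S <= 1 by rewrite xW.
  have dx2 : cross E [set x] S <= 2 by case/orP: dx => [/leqW //|/andP[]].
  case: (posnP (cross E [set x] A)) => sx.
    have [|a ha] := @avoid_colors c [set v in S | adj E x v]; first by rewrite -cross1_card.
    exists (fun v => if v == x then a else c v); apply: mono_proper_extend => //.
      by move=> v vS xv; apply: ha; rewrite inE vS.
    move=> w y wI yS _ wx; suff : 0 < cross E [set x] A by rewrite sx.
    by rewrite cross1_gt0; apply/existsP; exists w; rewrite wI (adjC simpleE).
  have dx1 : cross E [set x] S <= 1 by case/orP: dx => // /andP[_ /eqP e]; rewrite e in sx.
  move: (sx); rewrite cross1_gt0 => /existsP[y /andP[yA xy]].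
  have yS : y \in S by move: yA; rewrite inE => /andP[].
  have uniq v : v \in S -> adj E x v -> v = y by move=> vS xv; apply: (cross1_le1 dx1).
  (* Here [x] is an unmarked leaf at a marked [y]: to keep the neighbourhood of [y] monochromatic,
     [x] copies the colour of another neighbour [z] of [y], if there is one. *)
  have [z /and3P[zS nzx yz]|noz] := pickP [pred z | [&& z \in S, z != x & adj E y z]].
    exists (fun v => if v == x then c z else c v); apply: mono_proper_extend => //.
      move=> v vS /(uniq _ vS) ->; rewrite eq_sym; apply: (proj1 hc) => //; rewrite !inE ?nzx //.
      by rewrite yS eq_sym (adj_neq simpleE xy).
    move=> w v wI vS nvx wx wv; have ew : w = y.
      by apply: uniq; [move: wI; rewrite inE => /andP[] | rewrite (adjC simpleE)].
    apply: (proj2 hc y) => //; rewrite ?inE ?nzx ?nvx ?zS ?vS -?ew //.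
    rewrite ew eq_sym (adj_neq simpleE xy) yS !andbT.
    by move: yA; rewrite inE => /andP[].
  have [|a ha] := @avoid_colors c [set y]; first by rewrite cards1.
  exists (fun v => if v == x then a else c v); apply: mono_proper_extend => //.
    by move=> v vS /(uniq _ vS) ->; apply: ha; rewrite inE.
  move=> w v wI vS nvx wx wv; have ew : w = y.
    by apply: uniq; [move: wI; rewrite inE => /andP[] | rewrite (adjC simpleE)].
  by have := noz v; rewrite /= vS nvx -ew wv.
(* With no removable vertex, degree counting gives 2e(S) at least 3|B| and at least 2|S|. With
   5(e(S)+|A|) at most 6|S| this yields 4|A| <= |B| and 3|B| <= 2|A|, so [S] is empty. *)
have eS : S = B :|: A by rewrite /A /B setUC setIC setID.
have dBA : [disjoint B & A].
  by rewrite -setI_eq0; apply/eqP/setP => x; rewrite !inE; case: (x \in W); rewrite ?andbF.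
have cS : #|S| = #|B| + #|A| by rewrite {1}eS cardsU (disjoint_setI0 dBA) cards0 subn0.
have hB x : x \in B -> 2 <= cross E [set x] S /\ 3 <= cross E [set x] S + cross E [set x] A.
  rewrite inE => /andP[/negbTE xW xS]; have := norem x; rewrite /rem xS xW /=; lia.
have hA x : x \in A -> 2 <= cross E [set x] S.
  rewrite inE => /andP[xW xS]; have := norem x; rewrite /rem xS xW /=; lia.
have tA : 2 * #|A| <= cross E A S.
  rewrite mulnC -sum_nat_const; apply: leq_sum => x xA.
  by have := hA x xA; rewrite cross1l.
have tB : 2 * #|B| <= cross E B S.
  rewrite mulnC -sum_nat_const; apply: leq_sum => x xB.
  by have [] := hB x xB; rewrite !cross1l.
have tBA : 3 * #|B| <= cross E B S + cross E B A.
  rewrite mulnC -sum_nat_const -big_split; apply: leq_sum => x xB.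
  by have [] := hB x xB; rewrite !cross1l.
have sBA : cross E B A <= cross E A S.
  by rewrite crossC //; apply: cross_subr; apply: subsetDl.
have tot : cross E B S + cross E A S = (inner E S).*2.
  by rewrite -crossUl // -eS -handshake //; apply: eq_bigr => x _; rewrite cross1l.
have := sp S (subxx _); rewrite cS -/A => main.
have S0 : S = set0 by apply/eqP; rewrite -cards_eq0 cS; lia.
by exists (fun _ => ord0); split=> [u v|w x y]; rewrite S0 !inE ?andbF.
Qed.

End MonoColoring.

(** * Extending a 3-colouring from a closed set, locally *)

Section Extension.
Variables (n d : nat) (E : graphT n) (lab : 'I_n -> 'I_d.+1) (s1 : nat).
Hypothesis simpleE : simpleb E.
Hypothesis labE : forall u v, adj E u v -> lab u != lab v.
Implicit Types B D S T X Y W : {set 'I_n}.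
Local Notation closedb := (closedb E lab s1).

Lemma HomP X (phi : Defs.pmap n) : reflect
  (dom phi = X /\ forall u v, u \in X -> v \in X -> adj E u v -> phi u != phi v)
  (phi \in Defs.Hom E X).
Proof.
rewrite inE; apply: (iffP andP) => [[/eqP dX /forallP h]|[-> h]].
  by split=> // u v uX vX uv; have /forallP/(_ v) := h u; rewrite uX vX -/(adj E u v) uv.
split=> //; apply/forallP => u; apply/forallP => v; apply/implyP => /and3P[uX vX uv].
exact: h.
Qed.

Lemma restr_restr Y X (phi : Defs.pmap n) : restr Y (restr X phi) = restr (Y :&: X) phi.
Proof. by apply/ffunP => v; rewrite !ffunE inE; case: (v \in Y). Qed.

Lemma restr_id X (phi : Defs.pmap n) : dom phi = X -> restr X phi = phi.
Proof.
move=> dX; apply/ffunP => v; rewrite !ffunE -dX inE.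
by case: (phi v).
Qed.

Lemma restr_eq X (phi psi : Defs.pmap n) : (forall v, v \in X -> phi v = psi v) ->
  restr X phi = restr X psi.
Proof. by move=> h; apply/ffunP => v; rewrite !ffunE; case: ifP => // /h. Qed.

Lemma Hom_restr X Y (phi : Defs.pmap n) : Y \subset X -> phi \in Defs.Hom E X -> restr Y phi \in Defs.Hom E Y.
Proof.
move=> sYX /HomP[dX pr]; apply/HomP; split.
  apply/setP => v; rewrite inE ffunE; case: ifP => // vY.
  by have := subsetP sYX v vY; rewrite -dX inE.
by move=> u v uY vY uv; rewrite !ffunE uY vY; apply: pr; rewrite ?(subsetP sYX).
Qed.

(* The new colour of a vertex of [D] outside [B] depends only on the colour of its
   neighbour in [B], which lies below it, hence in every closed set containing it. *)
Lemma local_extension B D : closedb B -> B \subset D -> #|D| <= s1 ->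
  exists e : Defs.pmap n -> Defs.pmap n,
  [/\ forall phi, phi \in Defs.Hom E B -> e phi \in Defs.Hom E D,
      forall phi, restr B (e phi) = restr B phi &
      forall B' phi, closedb B' -> restr B' (e phi) = restr B' (e (restr (B :&: B') phi))].
Proof.
case/andP=> /downclosedP downB /(strongP _ simpleE) strB sBD cD.
pose T := D :\: B; pose W := [set w in T | [exists u in B, adj E w u]].
have TB v : v \in T -> v \notin B by rewrite inE => /andP[].
have cT S : S \subset T -> #|S| <= s1.
  by move=> sS; apply: leq_trans cD; apply/subset_leq_card/(subset_trans sS)/subsetDl.
have disT S : S \subset T -> [disjoint S & B].
  by move=> sS; rewrite disjoints_subset; apply/subsetP => v /(subsetP sS)/TB; rewrite inE.
(* Every marked vertex accounts for an edge into [B], so strength of [B] supplies the sparsity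
   condition of [mono_coloring] with the marks included. *)
have att S : S \subset T -> #|W :&: S| <= cross E S B.
  move=> sS; apply: (@leq_trans (cross E (W :&: S) B)).
    rewrite -sum1_card; apply: leq_sum => w; rewrite !inE => /andP[/andP[_ wB] _].
    by rewrite -cross1l cross1_gt0.
  exact/cross_subl/subsetIr.
have att1 w : w \in T -> cross E [set w] B <= 1.
  move=> wT; have sw : [set w] \subset T by rewrite sub1set.
  have := strB _ (disT _ sw) (cT _ sw); rewrite inner1 // cards1; lia.
have WI u v : u \in W -> v \in W -> ~~ adj E u v.
  move=> uW vW; apply/negP => uv.
  have uvT : [set u; v] \subset T.
    by rewrite subUset !sub1set; move: uW vW; rewrite !inE => /andP[-> _] /andP[-> _].
  have nuv : u \notin [set v] by rewrite inE (adj_neq simpleE uv).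
  have := att _ uvT; rewrite (setIidPr _) ?subUset ?sub1set ?uW // cardsU1 nuv cards1.
  have := strB _ (disT _ uvT) (cT _ uvT).
  rewrite inner_set1U // inner1 // cross1l big_set1 uv cardsU1 nuv cards1; lia.
have [|c [prc moc]] := @mono_coloring n E simpleE T W.
  move=> S sS; apply: leq_trans (strB S (disT _ sS) (cT _ sS)).
  by rewrite leq_mul2l leq_add2l att.
(* The alternative colour of [w] avoids [c w] and the common colour of its neighbours in [T]. Marked
   vertices being independent, simultaneous changes do not interfere. The default [c w] in [alt] is
   never reached for marked [w]. *)
pose altP w a := (a != c w) && [forall x in T, adj E w x ==> (a != c x)].
pose alt w := odflt (c w) [pick a | altP w a].
have altE w : w \in W -> altP w (alt w).
  move=> wW; rewrite /alt; case: pickP => //= noa.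
  have [x /andP[xT wx]|nox] := pickP [pred x | (x \in T) && adj E w x].
    have [|a ha] := @avoid_colors n c [set w; x]; first by rewrite cards2; case: (_ != _).
    case/negP: (noa a); rewrite /altP ha ?set21 //=.
    apply/'forall_in_implyP => y yT wy.
    rewrite (moc w y x) ?ha ?set22 // inE wW; move: wW; rewrite inE => /andP[-> _] //.
  have [|a ha] := @avoid_colors n c [set w]; first by rewrite cards1.
  case/negP: (noa a); rewrite /altP ha ?set11 //=.
  by apply/'forall_in_implyP => y yT wy; have := nox y; rewrite /= yT wy.
pose e (phi : Defs.pmap n) : Defs.pmap n := [ffun w => if w \in B then phi w else if w \in T then
   (if [pick u in B | adj E w u] is Some u then
      if phi u == Some (c w) then Some (alt w) else Some (c w) else Some (c w)) else None].
have eB phi v : v \in B -> e phi v = phi v by move=> vB; rewrite ffunE vB.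
have eT phi v : v \in T -> v \notin W -> e phi v = Some (c v).
  move=> vT vW; rewrite ffunE (negbTE (TB _ vT)) vT; case: pickP => // u /andP[uB vu].
  by case/negP: vW; rewrite inE vT; apply/existsP; exists u; rewrite uB.
have eW phi v : v \in T -> e phi v = Some (c v) \/ e phi v = Some (alt v).
  move=> vT; rewrite ffunE (negbTE (TB _ vT)) vT; case: pickP => [u _|_]; last by left.
  by case: ifP; [right | left].
exists e; split=> [phi /HomP[dB pr]|phi|B' phi /andP[/downclosedP downB' _]].
- apply/HomP; split.
    apply/setP => v; rewrite inE; case vB: (v \in B).
      by rewrite eB // (subsetP sBD) //; move: vB; rewrite -dB inE.
    case vT: (v \in T); last first.
      by rewrite ffunE vB vT; move: vT; rewrite inE vB /= => ->.
    have vD : v \in D by move: vT; rewrite inE vB.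
    by rewrite vD; case: (eW phi v vT) => ->.
  have inT v : v \in D -> v \notin B -> v \in T by move=> vD vB; rewrite inE vB.
  have mixed u v : u \in B -> v \in T -> adj E u v -> phi u != e phi v.
    move=> uB vT uv; rewrite ffunE (negbTE (TB _ vT)) vT.
    have vu : adj E v u by rewrite (adjC simpleE).
    case: pickP => [u' /andP[u'B vu']|/(_ u)]; last by rewrite uB vu.
    rewrite (cross1_le1 (att1 v vT) u'B uB vu' vu).
    case: (eqVneq (phi u) (Some (c v))) => [->|//].
    have vW : v \in W by rewrite inE vT; apply/existsP; exists u; rewrite uB.
    by have /andP[] := altE v vW; rewrite eq_sym.
  have half u v : u \in T -> v \in T -> v \notin W -> adj E u v -> e phi u != e phi v.
    move=> uT vT vW uv; rewrite (eT phi v vT vW).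
    case uW: (u \in W); last by rewrite eT ?uW //; apply: prc.
    case: (eW phi u uT) => ->; first exact: prc.
    by have /andP[_ /'forall_in_implyP h] := altE u uW; apply: h.
  move=> u v uD vD uv; case uB: (u \in B); case vB: (v \in B).
  + by rewrite !eB //; apply: pr.
  + by rewrite eB //; apply: mixed; rewrite ?inT ?vB.
  + by rewrite eq_sym [e _ v]eB //; apply: mixed; rewrite ?inT ?uB // (adjC simpleE).
  + have uT := inT u uD (negbT uB); have vT := inT v vD (negbT vB).
    case vW: (v \in W); last by apply: half; rewrite ?vW.
    rewrite eq_sym; apply: half; rewrite // ?(adjC simpleE v) //.
    by apply: contraL uv => uW; apply: WI.
- by apply: restr_eq => v vB; rewrite eB.
apply: restr_eq => v vB'; rewrite !ffunE; case: ifP => [vB|vB].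
  by rewrite inE vB vB'.
case: ifP => // vT; case: pickP => // u /andP[uB vu].
(* If [u] were not below [v], then [v] would be below [u], and downward closure of [B] would put [v]
   into [B]. *)
rewrite ffunE inE uB /=; suff -> : u \in B' by [].
apply: (downB' v) => //; rewrite /below vu /= ltnNge; apply/negP => le.
have lt : lab v < lab u.
  by rewrite ltn_neqAle le andbT; have := labE vu; apply: contra => /eqP/val_inj ->.
by have := downB u v uB; rewrite /below (adjC simpleE) vu lt vB => /(_ isT).
Qed.

End Extension.

(** * Compatible families of integer measures *)

Section Pushforward.
Import GRing.Theory.
Local Open Scope ring_scope.
Variable A : zmodType.

(** The image measure. Values lie in an arbitrary abelian group, so that measures can be
    subtracted. *)
Definition pushf (T T' : finType) (f : T -> T') (m : T -> A) (y : T') : A :=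
  \sum_(x | f x == y) m x.

Lemma pushf_comp (T T' T'' : finType) (f : T -> T') (g : T' -> T'') m :
  pushf g (pushf f m) =1 pushf (g \o f) m.
Proof.
move=> z; rewrite /pushf [RHS](partition_big f (fun y => g y == z)) //=.
apply: eq_bigr => y /eqP gy; apply: eq_bigl => x; rewrite andbC.
by case: (eqVneq (f x) y) => //= ->; rewrite gy eqxx.
Qed.

Lemma eq_pushf (T T' : finType) (f g : T -> T') m m' : f =1 g -> m =1 m' ->
  pushf f m =1 pushf g m'.
Proof. by move=> fg mm y; apply: eq_big => [x|x _]; rewrite ?fg ?mm. Qed.

Lemma pushfD (T T' : finType) (f : T -> T') m m' y :
  pushf f (fun x => m x + m' x) y = pushf f m y + pushf f m' y.
Proof. exact: big_split. Qed.

Lemma pushfB (T T' : finType) (f : T -> T') m m' y :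
  pushf f (fun x => m x - m' x) y = pushf f m y - pushf f m' y.
Proof. exact: GRing.sumrB. Qed.

Lemma pushf0 (T T' : finType) (f : T -> T') m y : (forall x, m x = 0) -> pushf f m y = 0.
Proof. by move=> m0; rewrite /pushf big1. Qed.

Lemma pushf_id (T : finType) (f : T -> T) m : (forall x, m x != 0 -> f x = x) -> pushf f m =1 m.
Proof.
move=> h y; rewrite /pushf big_mkcond (bigD1 y) //= big1 ?addr0 => [|x nxy].
  by case: (eqVneq (m y) 0) => [->|/h ->]; rewrite ?if_same ?eqxx.
case: (eqVneq (m x) 0) => [->|/h ->]; first by rewrite if_same.
by rewrite (negbTE nxy).
Qed.

End Pushforward.

Section Families.
Import GRing.Theory.
Local Open Scope ring_scope.
Variables (n d : nat) (E : graphT n) (lab : 'I_n -> 'I_d.+1) (s1 : nat) (A : zmodType).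
Hypothesis simpleE : simpleb E.
Hypothesis labE : forall u v, adj E u v -> lab u != lab v.
Implicit Types B D X Y : {set 'I_n}.
Local Notation closed := (closedb E lab s1).

Definition supported X (m : Defs.pmap n -> A) := forall phi, phi \notin Defs.Hom E X -> m phi = 0.

Definition marg X (m : Defs.pmap n -> A) := pushf (restr X) m.

Lemma marg_marg X Y m : marg Y (marg X m) =1 marg (Y :&: X) m.
Proof.
move=> phi; rewrite /marg pushf_comp; apply: eq_pushf => // psi /=.
exact: restr_restr.
Qed.

Lemma marg_supported X m : supported X m -> marg X m =1 m.
Proof.
move=> sm; apply: pushf_id => phi nz; apply: restr_id.
have /HomP[-> //] : phi \in Defs.Hom E X by apply: contraNT nz => /sm ->.
Qed.

(** Sets are treated one at a time. The discrepancy [t] between [mu B] and the current marginal on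
    [B] is pushed to [D] by the local extension [e] and added. For an earlier [B'] the marginal of
    this correction depends only on the marginal of [t] on the intersection of [B] and [B'], which
    vanishes because both measures agree there with [mu B']. *)
Lemma glue_measures D (mu : {set 'I_n} -> Defs.pmap n -> A) (Bs : seq {set 'I_n}) :
  (#|D| <= s1)%N ->
  (forall B, B \in Bs -> [/\ closed B, B \subset D & supported B (mu B)]) ->
  (forall B B', B \in Bs -> B' \in Bs ->
     marg (B :&: B') (mu B) =1 marg (B :&: B') (mu B')) ->
  exists2 m, supported D m & forall B, B \in Bs -> marg B m =1 mu B.
Proof.
move=> cD; elim: Bs => [|B Bs IH] hB compat; first by exists (fun _ => 0).
have [||m sm hm] := IH.
- by move=> B' B'in; apply: hB; rewrite inE B'in orbT.
- by move=> B1 B2 i1 i2; apply: compat; rewrite inE ?i1 ?i2 orbT.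
have [cB sB suB] := hB B (mem_head _ _).
have [e [eH er el]] := local_extension simpleE labE cB sB cD.
pose t phi := mu B phi - marg B m phi.
have st : supported B t.
  move=> phi nphi; rewrite /t suB // sub0r /marg /pushf big1 ?oppr0 // => psi /eqP eps.
  apply: sm; apply: contra nphi => psiD; rewrite -eps; exact: Hom_restr sB psiD.
exists (fun phi => m phi + pushf e t phi) => [phi nphi|B'].
  rewrite sm // add0r /pushf big1 // => psi /eqP eps; apply: st.
  by apply: contra nphi => psiB; rewrite -eps; apply: eH.
rewrite inE => /orP[/eqP ->|B'in] phi; rewrite /marg pushfD pushf_comp.
  have -> : pushf (restr B \o e) t phi = marg B t phi.
    by apply: eq_pushf => // psi; apply: er.
  by rewrite (marg_supported st) /t -/(marg B m phi) addrC subrK.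
have [|cB' sB' _] := hB B'; first by rewrite inE B'in orbT.
rewrite -/(marg B' m phi) hm //.
have -> : pushf (restr B' \o e) t phi = pushf (restr B' \o e \o restr (B :&: B')) t phi.
  by apply: eq_pushf => // psi; apply: el.
rewrite -pushf_comp pushf0 ?addr0 // => psi.
rewrite pushfB -/(marg _ (mu B) psi) -/(marg _ (marg B m) psi).
rewrite marg_marg setIAC setIid (compat B B') ?mem_head ?inE ?B'in ?orbT //.
have -> : marg (B :&: B') m psi = marg (B :&: B') (marg B' m) psi.
  by rewrite marg_marg -setIA setIid.
apply/eqP; rewrite subr_eq0; apply/eqP; apply: eq_pushf => // x.
by rewrite hm.
Qed.

(** Induction on |D| - |A0|. The proper closed subsets of [D] containing [A0] are stable under
    intersection, so the measures from lower levels are compatible and glue to [mu D]. *)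
Lemma consistent_family (A0 : {set 'I_n}) (m0 : Defs.pmap n -> A) : supported A0 m0 ->
  exists mu : {set 'I_n} -> Defs.pmap n -> A, mu A0 = m0 /\
    forall D, closed D -> A0 \subset D -> (#|D| <= s1)%N -> supported D (mu D) /\
      forall B, closed B -> A0 \subset B -> B \subset D -> marg B (mu D) =1 mu B.
Proof.
move=> s0.
suff /(_ n)[mu [mu0 hmu]] : forall i, exists mu : {set 'I_n} -> Defs.pmap n -> A, mu A0 = m0 /\
    forall D, closed D -> A0 \subset D -> (#|D| <= s1)%N -> (#|D| <= #|A0| + i)%N ->
      supported D (mu D) /\
      forall B, closed B -> A0 \subset B -> B \subset D -> marg B (mu D) =1 mu B.
  exists mu; split=> // D cD sD lD; apply: hmu => //.
  by apply: leq_trans (leq_addl _ _); rewrite -[n in X in (_ <= X)%N]card_ord max_card.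
elim=> [|i [mu [mu0 hmu]]].
  exists (fun _ => m0); split=> // D cD sD lD; rewrite addn0 => lA.
  have eD : A0 = D by apply/eqP; rewrite eqEcard sD.
  rewrite -eD; split=> // B _ sB sBA; have -> : B = A0 by apply/eqP; rewrite eqEsubset sBA.
  exact: marg_supported.
pose good D := [&& closed D, A0 \subset D & (#|D| <= s1)%N].
(* Stated for every [D], with [m0] as a dummy value off the current level, so that choice yields a
   total function. *)
have ex D : exists m, good D -> #|D| = (#|A0| + i).+1 ->
    supported D m /\ forall B, closed B -> A0 \subset B -> B \proper D -> marg B m =1 mu B.
  case gD: (good D); last by exists m0.
  case: (eqVneq #|D| (#|A0| + i).+1) => [eD|/eqP neD]; last by exists m0.
  have /and3P[cD sD lD] := gD.
  pose Bs := [seq B <- enum {set 'I_n} | [&& closed B, A0 \subset B & B \proper D]].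
  have inBs B : B \in Bs = [&& closed B, A0 \subset B & B \proper D].
    by rewrite mem_filter mem_enum andbT.
  have small B : B \in Bs -> [/\ closed B, A0 \subset B, B \subset D,
      (#|B| <= s1)%N & (#|B| <= #|A0| + i)%N].
    rewrite inBs => /and3P[cB sB pB]; have lt := proper_card pB.
    by rewrite cB sB (proper_sub pB); split=> //; [apply: leq_trans (ltnW lt) lD | rewrite eD ltnS in lt].
  have [||m sm hm] := @glue_measures D mu Bs lD.
  - by move=> B /small[cB sB sBD l1 l2]; have [] := hmu B cB sB l1 l2.
  - move=> B B' /small[cB sB sBD l1 l2] /small[cB' sB' sBD' l1' l2'] phi.
    have cI : closed (B :&: B') by apply: closedI.
    have sI : A0 \subset B :&: B' by rewrite subsetI sB.
    have [_ h] := hmu B cB sB l1 l2; have [_ h'] := hmu B' cB' sB' l1' l2'.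
    by rewrite h ?subsetIl // h' ?subsetIr.
  exists m => _ _; split=> // B cB sB pB; apply: hm.
  by rewrite inBs cB sB.
pose f D := proj1_sig (constructive_indefinite_description _ (ex D)).
have fP D := proj2_sig (constructive_indefinite_description _ (ex D)).
exists (fun D => if (#|D| <= #|A0| + i)%N then mu D else f D).
rewrite leq_addr; split=> // D cD sD lD; rewrite addnS leq_eqVlt ltnS.
case: leqP => [le _|lt]; last rewrite orbF => /eqP eD.
  have [h1 h2] := hmu D cD sD lD le; split=> // B cB sB sBD.
  by rewrite (leq_trans (subset_leq_card sBD) le); apply: h2.
have gD : good D by rewrite /good cD sD.
have [sm hm] := fP D gD eD; split=> // B cB sB sBD.
case: (leqP #|B| (#|A0| + i)) => lB.
  apply: hm => //; rewrite properEneq sBD andbT; apply: contraTneq lB => ->.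
  by rewrite -ltnNge.
have -> : B = D by apply/eqP; rewrite eqEcard sBD eD.
exact: marg_supported.
Qed.

End Families.

(** * Acceptance for locally sparse graphs *)

Lemma decPP (P : Prop) : reflect P (Defs.decP P).
Proof. by rewrite /Defs.decP; case: excluded_middle_informative => h; constructor. Qed.

Section Acceptance.
Import GRing.Theory.
Variables (n k : nat) (E : graphT n).
Implicit Types X Y : {set 'I_n}.

(** A family vanishing outside [H] may be summed over all partial maps, so the equations no longer
    mention [H]. The same family then serves for every collection containing its support. *)
Lemma Lsolvable_intro (H : coll n) (X0 : {set 'I_n}) phi0 (x : {set 'I_n} -> Defs.pmap n -> Z) :
  (forall X phi, #|X| <= k -> phi \notin H X -> x X phi = 0%R) ->
  (forall X, #|X| <= k -> (\sum_phi x X phi = 1)%R) ->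
  (forall X Y, #|X| <= k -> Y \subset X -> forall psi,
     (\sum_(phi | restr Y phi == psi) x X phi = x Y psi)%R) ->
  (forall psi, x X0 psi = if psi == phi0 then 1%R else 0%R) ->
  Lsolvable k E H X0 phi0.
Proof.
move=> supp tot mar base; exists x; split; [|split; [|split]].
- move=> X cX; rewrite -[LHS]/(\sum_(phi in H X) x X phi)%R -[RHS]/(1%R : Z) -(tot X cX).
  rewrite big_mkcond; apply: eq_bigr => phi _; case: ifPn => // nphi.
  by rewrite supp.
- move=> X Y cX sYX psi psiY; rewrite -(mar X Y cX sYX psi).
  rewrite -[LHS]/(\sum_(phi in H X | restr Y phi == psi) x X phi)%R.
  rewrite big_mkcondl; apply: eq_bigr => phi _; case: ifPn => // nphi.
  by rewrite supp.
- by rewrite base eqxx.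
- by move=> psi _ npsi; rewrite base (negbTE npsi).
Qed.

(** [kap] is a loop invariant: being consistent, it stays inside the maximal consistent
    subcollection, and the solutions protect its members from removal. It must be empty above size
    [k] because the initial collection is. *)
Lemma accepts_intro (kap : coll n) : consistentb k E kap ->
  (forall X, #|X| <= k -> kap X != set0) ->
  (forall X, k < #|X| -> kap X = set0) ->
  (forall (H : coll n) X phi, subcollb kap H -> #|X| <= k -> phi \in kap X ->
     Lsolvable k E H X phi) ->
  accepts k E.
Proof.
move=> cons ne big sol.
have inv i : subcollb kap (iter i (alg_step k E) (alg_init k E)).
  elim: i => [|i IH].
    apply/forallP => X; rewrite /= ffunE; case: leqP => [cX|/big -> //].
    by have /forallP/(_ X) := cons; rewrite cX => /andP[].
  have sub1 : subcollb kap (maxsub k E (iter i (alg_step k E) (alg_init k E))).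
    apply/forallP => X; apply/subsetP => phi phiX; rewrite ffunE inE.
    by apply/existsP; exists kap; rewrite cons IH.
  apply/forallP => X; apply/subsetP => phi phiX; rewrite iterS ffunE inE.
  rewrite (subsetP (forallP sub1 X)) //=; apply/implyP => cX; apply/decPP.
  exact: sol.
apply/forallP => X; apply/implyP => cX; apply: contraNneq (ne X cX) => eX.
by rewrite -subset0 -eX; apply: (forallP (inv _)).
Qed.

Lemma total_pushf (A : zmodType) (T T' : finType) (f : T -> T') (m : T -> A) :
  (\sum_y pushf f m y = \sum_x m x)%R.
Proof. by rewrite (partition_big f xpredT). Qed.

Variable d : nat.
Hypothesis simpleE : simpleb E.
Hypothesis degE : forall u, #|[set v | adj E u v]| <= d.
(** Bounds the closure of the union of two sets of size at most [k]: the set of a variable and the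
    set whose value is prescribed. *)
Let s1 := (30 * d + 16) * (2 * k) * d.+1 ^ d.
Hypothesis sparseE : forall S : {set 'I_n}, #|S| <= (30 * d + 16) * (2 * k) + (2 * d + 1) * s1 ->
  (20 * d + 10) * inner E S <= (20 * d + 11) * #|S|.

Theorem accepts_sparse : accepts k E.
Proof.
have [lab labE] := greedy_labels simpleE degE.
pose C := cl E lab s1; pose closed := closedb E lab s1.
have cC X : closed (C X) by apply: closed_cl.
have sizeC X : #|X| <= 2 * k -> #|C X| <= s1.
  move=> cX; apply: leq_trans (card_cl lab simpleE degE sparseE _) _.
    by rewrite leq_add2r leq_mul2l cX orbT.
  by rewrite /s1 leq_mul2r leq_mul2l cX !orbT.
have sizeC1 X : #|X| <= k -> #|C X| <= s1.
  by move=> cX; apply: sizeC; apply: leq_trans cX _; rewrite leq_pmull.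
have c0 : closed set0.
  apply/andP; split; first by apply/downclosedP => w u; rewrite inE.
  apply/(strongP _ simpleE) => T _ cT.
  have -> : cross E T set0 = 0 by rewrite /cross big1 // => u _; rewrite big_set0.
  have [|h] := leqP #|T| ((30 * d + 16) * (2 * k) + (2 * d + 1) * s1); last by nia.
  by move/sparseE => h; rewrite addn0; nia.
(* Only those colourings of [X] are kept that extend to the closure of [X]. *)
pose kap : coll n := [ffun X : {set 'I_n} =>
  if #|X| <= k then [set restr X psi | psi in Defs.Hom E (C X)] else set0].
have kapE X : #|X| <= k -> kap X = [set restr X psi | psi in Defs.Hom E (C X)].
  by move=> cX; rewrite ffunE cX.
apply: (@accepts_intro kap).
- apply/forallP => X; apply/implyP => cX; apply/andP; split.
    rewrite kapE //; apply/subsetP => phi /imsetP[psi psiC ->].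
    exact: Hom_restr (sub_cl _ _ _ _) psiC.
  apply/forallP => Y; apply/implyP => sYX.
  have cY : #|Y| <= k by apply: leq_trans (subset_leq_card sYX) cX.
  have sYC : C Y \subset C X by apply: cl_mono.
  have sY : Y \subset C Y by apply: sub_cl.
  have sX : X \subset C X by apply: sub_cl.
  apply/andP; split; apply/forallP => phi; apply/implyP; rewrite !kapE //.
    case/imsetP=> psi psiC ->.
    have [e [eH er _]] := local_extension simpleE labE (cC Y) sYC (sizeC1 X cX).
    apply/existsP; exists (restr X (e psi)); rewrite imset_f ?eH //= restr_restr (setIidPl sYX).
    apply/eqP; move/(congr1 (restr Y)): (er psi); rewrite !restr_restr.
    by rewrite (setIidPl sY).
  case/imsetP=> psi psiC ->; apply/imsetP; exists (restr (C Y) psi).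
    exact: Hom_restr psiC.
  by rewrite !restr_restr (setIidPl sYX) (setIidPl sY).
- move=> X cX; rewrite kapE //; apply/set0Pn.
  have [e [eH _ _]] := local_extension simpleE labE c0 (sub0set (C X)) (sizeC1 X cX).
  exists (restr X (e [ffun=> None])); apply: imset_f; apply: eH; apply/HomP.
  split; last by move=> u v; rewrite inE.
  by apply/setP => v; rewrite !inE ffunE.
- by move=> X lt; rewrite ffunE leqNgt lt.
move=> H X0 phi0 sub cX0; rewrite kapE // => /imsetP[psi0 psi0C ephi0].
have [mu [mu0 hmu]] := @consistent_family n d E lab s1 Z simpleE labE (C X0)
  (fun phi => if phi == psi0 then 1%R else 0%R)
  (fun phi nphi => ifN _ _ (contraNneq (fun e => eq_ind_r (fun p => p \in _) psi0C e) nphi)).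
(* The measures exist only on closed sets containing [C X0], so the variable at [X] is read off as a
   marginal of the measure on the closure of [X] and [X0] together. *)
pose D X := C (X :|: X0).
have sD X : X \subset D X := subset_trans (subsetUl _ _) (sub_cl _ _ _ _).
have s0D X : C X0 \subset D X by apply: cl_mono => //; apply: subsetUr.
have cD X : #|X| <= k -> #|D X| <= s1.
  move=> cX; apply: sizeC; apply: leq_trans (leq_card_setU _ _) _.
  by rewrite mul2n -addnn leq_add.
apply: (@Lsolvable_intro H X0 phi0 (fun X => marg X (mu (D X)))).
- move=> X phi cX nphi; rewrite /marg /pushf big1 // => psi /eqP epsi.
  have [sm _] := hmu _ (cC _) (s0D X) (cD X cX); apply: sm.
  apply: contra nphi => psiD; apply: (subsetP (forallP sub X)); rewrite kapE //.
  apply/imsetP; exists (restr (C X) psi); last by rewrite restr_restr (setIidPl (sub_cl _ _ _ _)).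
  by apply: Hom_restr psiD; apply: cl_mono => //; apply: subsetUl.
- move=> X cX; rewrite total_pushf.
  have [_ hm] := hmu _ (cC _) (s0D X) (cD X cX).
  rewrite -(total_pushf (restr (C X0))) (eq_bigr (mu (C X0))) => [|psi _]; last exact: (hm _ (cC X0) (subxx _) (s0D X) psi).
  rewrite mu0 (bigD1 psi0) //= eqxx big1 ?addr0 // => psi npsi.
  by rewrite (negbTE npsi).
- move=> X Y cX sYX psi; rewrite -/(pushf (restr Y) _ psi) -/(marg Y _ psi).
  have [_ hm] := hmu _ (cC _) (s0D X) (cD X cX).
  have sDY : D Y \subset D X by apply: cl_mono => //; apply: setSU.
  rewrite marg_marg (setIidPl sYX).
  have -> : marg Y (mu (D Y)) psi = marg Y (marg (D Y) (mu (D X))) psi.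
    by apply: eq_pushf => // phi; symmetry; exact: (hm _ (cC _) (s0D Y) sDY phi).
  by rewrite marg_marg (setIidPl (sD Y)).
move=> psi; rewrite /D setUid mu0 /marg /pushf big_mkcond (bigD1 psi0) //= eqxx.
rewrite big1 ?addr0 => [|phi nphi]; last by rewrite (negbTE nphi) if_same.
by rewrite -ephi0 eq_sym.
Qed.

End Acceptance.

(** * Switchings *)

Lemma card_dep_pairs (T U : finType) (C : {set T}) (V : T -> {set U}) :
  #|[set q : T * U | (q.1 \in C) && (q.2 \in V q.1)]| = \sum_(x in C) #|V x|.
Proof.
rewrite -sum1dep_card; under [RHS]eq_bigr do rewrite -sum1_card.
by rewrite pair_big_dep.
Qed.

(** Pairs (x, p) with p a move available at x inject into pairs (y, p) with p a possible trace at y: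
    [f] applies the move and p is kept, so injectivity is needed only for fixed p. *)
Lemma double_count (T U : finType) (A B : {set T}) (f : T -> U -> T)
    (VA VB : T -> {set U}) lo hi :
  (forall x, x \in A -> lo <= #|VA x|) -> (forall x, x \in B -> #|VB x| <= hi) ->
  (forall x p, x \in A -> p \in VA x -> f x p \in B /\ p \in VB (f x p)) ->
  (forall x x' p, x \in A -> x' \in A -> p \in VA x -> p \in VA x' ->
     f x p = f x' p -> x = x') ->
  #|A| * lo <= #|B| * hi.
Proof.
move=> hlo hhi hf inj.
pose PA := [set q : T * U | (q.1 \in A) && (q.2 \in VA q.1)].
pose PB := [set q : T * U | (q.1 \in B) && (q.2 \in VB q.1)].
apply: (@leq_trans #|PA|).
  by rewrite card_dep_pairs -sum_nat_const; apply: leq_sum.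
apply: (@leq_trans #|PB|); last first.
  by rewrite card_dep_pairs -sum_nat_const; apply: leq_sum.
pose g (q : T * U) := (f q.1 q.2, q.2).
have injg : {in PA &, injective g}.
  move=> [x p] [x' p'] /[!inE] /= /andP[xA pV] /andP[x'A pV'] [ef ep].
  by subst p'; rewrite (inj x x' p).
rewrite -(card_in_imset injg); apply: subset_leq_card; apply/subsetP => _ /imsetP[[x p] h ->].
by move: h; rewrite !inE /= => /andP[xA pV]; have [-> ->] := hf x p xA pV.
Qed.

Section Switching.
Variables (n d : nat).
Implicit Types (E F : graphT n) (S : {set 'I_n}).

Lemma regularP E : reflect (simpleb E /\ forall u, #|[set v | (u, v) \in E]| = d)
  (E \in regular_graphs n d).
Proof.
rewrite inE; apply: (iffP andP) => [[sE /forallP h]|[sE h]]; split=> //.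
  by move=> u; apply/eqP.
by apply/forallP => u; apply/eqP.
Qed.

Lemma simpleP E : reflect ((forall u v, ((u, v) \in E) = ((v, u) \in E)) /\ forall u, (u, u) \notin E)
  (simpleb E).
Proof.
apply: (iffP idP) => [sE|[sy ir]].
  by split=> [u v|u]; [exact: adjC sE u v | rewrite -/(adj E u u) adjxx].
apply/andP; split; last by apply/forallP.
by apply/forallP => u; apply/forallP => v; apply/implyP; rewrite sy.
Qed.

Definition fourset (a b c e : 'I_n) : {set 'I_n * 'I_n} := [set (a, b); (b, a); (c, e); (e, c)].

Definition switch E (a b c e : 'I_n) : graphT n := (E :\: fourset a b c e) :|: fourset a c b e.

Definition switchable E (a b c e : 'I_n) :=
  [&& (a, b) \in E, (c, e) \in E, a != c, b != e, (a, c) \notin E & (b, e) \notin E].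

Lemma card_swap (T : finType) (A : {set T}) x y : x \in A -> y \notin A -> #|y |: (A :\ x)| = #|A|.
Proof. by move=> xA yA; rewrite cardsU1 (cardsD1 x A) xA !inE negb_and yA orbT. Qed.

Lemma four_in E a b c e : simpleb E -> (a, b) \in E -> (c, e) \in E ->
  fourset a b c e \subset E.
Proof.
move=> /simpleP[sy _] ab ce; apply/subsetP => p.
by rewrite !inE -!orbA => /or4P[] /eqP ->; rewrite // sy.
Qed.

Lemma four_notin E a b c e p : simpleb E -> (a, b) \notin E -> (c, e) \notin E ->
  p \in fourset a b c e -> p \notin E.
Proof.
move=> /simpleP[sy _] ab ce.
by rewrite !inE -!orbA => /or4P[] /eqP ->; rewrite // sy.
Qed.

Lemma switchK E a b c e : simpleb E -> switchable E a b c e ->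
  switch (switch E a b c e) a c b e = E.
Proof.
move=> sE /and5P[ab ce _ _ /andP[nac nbe]]; rewrite /switch.
apply/setP => p; rewrite in_setU in_setD in_setU in_setD.
case p1: (p \in fourset a b c e); first by rewrite orbT (subsetP (four_in sE ab ce)).
rewrite orbF /=; case p2: (p \in fourset a c b e) => /=.
  by rewrite (negbTE (four_notin sE nac nbe p2)).
by rewrite orbF.
Qed.

(** The four endpoints are distinct, and each of them trades exactly one neighbour for another. *)
Lemma switch_regular E a b c e : E \in regular_graphs n d -> switchable E a b c e ->
  switch E a b c e \in regular_graphs n d.
Proof.
move=> /regularP[sE dE] sw; have /and5P[ab ce nac nbe /andP[xac xbe]] := sw.
have [sy ir] := simpleP _ sE.
have neE u v : (u, v) \in E -> u != v.
  by move=> uv; apply: contraTneq uv => ->; apply: ir.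
have nab := neE _ _ ab; have nce := neE _ _ ce.
have nae : a != e by apply: contraNneq xac => ->; rewrite sy.
have nbc : b != c by apply: contraNneq xbe => ->.
have [nba nec] : b != a /\ e != c by split; rewrite eq_sym.
have [nea ncb] : e != a /\ c != b by split; rewrite eq_sym.
have [nca neb] : c != a /\ e != b by split; rewrite eq_sym.
apply/regularP; split.
  apply/simpleP; split=> [u v|u]; rewrite !inE !xpair_eqE /=.
    rewrite sy; congr ((_ && _) || _); first congr (~~ _).
      by rewrite !(andbC (v == _)) [X in _ = X]orbC !orbA; case: (_ && _); case: (_ && _); case: (_ && _); case: (_ && _).
    by rewrite !(andbC (v == _)) [X in _ = X]orbC !orbA; case: (_ && _); case: (_ && _); case: (_ && _); case: (_ && _).
  have h x y : x != y -> (u == x) && (u == y) = false.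
    by move=> nxy; apply/negbTE; apply: contra nxy => /andP[/eqP <- /eqP <-].
  by rewrite (negbTE (ir u)) andbF !h.
have nF := (negbTE nab, negbTE nce, negbTE nae, negbTE nbc, negbTE nba, negbTE nec,
  negbTE nea, negbTE ncb, negbTE nca, negbTE neb, negbTE nac, negbTE nbe).
have row u x y : (u, x) \in E -> (u, y) \notin E ->
    (forall v, ((u, v) \in switch E a b c e) = (v == y) || (v != x) && ((u, v) \in E)) ->
    #|[set v | (u, v) \in switch E a b c e]| = d.
  move=> ux uy h; rewrite -(dE u) -(@card_swap _ [set v | (u, v) \in E] x y) ?inE //.
  by apply: eq_card => v; rewrite in_set h !inE.
move=> u; case: (eqVneq u a) => [->|ua].
  apply: (row a b c) => // v; rewrite !inE !xpair_eqE !eqxx !nF /= ?orbF.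
  by rewrite orbC.
case: (eqVneq u b) => [->|ub].
  apply: (row b a e); rewrite // ?(sy b) // => v; rewrite !inE !xpair_eqE !eqxx !nF /= ?orbF.
  by rewrite orbC.
case: (eqVneq u c) => [->|uc].
  apply: (row c e a); rewrite // 1?(sy c) // => v; rewrite !inE !xpair_eqE !eqxx !nF /= ?orbF.
  by rewrite orbC.
case: (eqVneq u e) => [->|ue].
  apply: (row e c b); rewrite // ?(sy e) // => v; rewrite !inE !xpair_eqE !eqxx !nF /= ?orbF.
  by rewrite orbC.
rewrite -(dE u); apply: eq_card => v; rewrite !inE !xpair_eqE.
by rewrite (negbTE ua) (negbTE ub) (negbTE uc) (negbTE ue) /= orbF.
Qed.


Lemma card_tails E S : E \in regular_graphs n d -> #|[set p in E | p.1 \in S]| = #|S| * d.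
Proof.
case/regularP=> _ dE; rewrite -sum_nat_const -(eq_bigr _ (fun u _ => dE u)).
rewrite -card_dep_pairs; apply: eq_card => -[u v]; rewrite !inE /= andbC.
by [].
Qed.

Lemma card_heads E S : E \in regular_graphs n d -> #|[set p in E | p.2 \in S]| = #|S| * d.
Proof.
move=> rE; rewrite -(card_tails S rE); have /regularP[/simpleP[sy _] _] := rE.
have swI : injective (fun p : 'I_n * 'I_n => (p.2, p.1)) by move=> [u v] [u' v'] [-> ->].
rewrite -(card_imset _ swI); apply: eq_card => -[u v]; rewrite [RHS]inE /=.
apply/imsetP/andP => [[[u' v'] /[!inE] /= /andP[uv vS] [-> ->]]|[uv uS]].
  by rewrite sy.
by exists (v, u); rewrite // inE /= sy uv.
Qed.

Lemma card_regular E : E \in regular_graphs n d -> #|E| = n * d.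
Proof.
move=> rE; rewrite -[n in RHS]card_ord -cardsT -(card_tails setT rE).
by apply: eq_card => p; rewrite !inE andbT.
Qed.

Lemma card_closed_nbhd E u : E \in regular_graphs n d -> #|u |: [set v | (u, v) \in E]| <= d.+1.
Proof.
case/regularP=> _ dE; rewrite -(dE u).
by apply: leq_trans (leq_card_setU _ _) _; rewrite cards1.
Qed.

Definition containing F := [set E in regular_graphs n d | F \subset E].

(** Switch [uv] away together with an arc [xy] that avoids [F], its reversal, and the neighbourhoods
    of [u] and [v]. At least nd/2 arcs qualify, while the result is undone by choosing a neighbour
    of [u] and one of [v], in d^2 ways; the ratio is 2d/n. *)
Lemma containing_step F u v : u != v -> (u, v) \notin F -> (v, u) \notin F ->
  4 * #|F| + 4 * (d.+1 * d) <= n * d ->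
  #|containing ((u, v) |: F)| * n <= #|containing F| * (2 * d).
Proof.
move=> nuv uvF vuF big.
pose nb E w := w |: [set x | (w, x) \in E].
pose rF : graphT n := [set (p.2, p.1) | p in F].
pose VA E := E :\: (F :|: rF :|: [set p in E | p.1 \in nb E u] :|: [set p in E | p.2 \in nb E v]).
pose VB E := [set p : 'I_n * 'I_n | ((u, p.1) \in E) && ((v, p.2) \in E)].
pose lo := n * d - (2 * #|F| + 2 * (d.+1 * d)).
(* A factor [d] is cancelled below; for [d = 0] no graph contains [uv]. *)
case: (posnP d) => [d0|d0].
  rewrite (_ : containing _ = set0) ?cards0 //; apply/setP => E; rewrite !inE; apply/negP.
  case/andP=> /andP[sE /forallP/(_ u)/eqP du]; rewrite subUset sub1set => /andP[uv _].
  have := card0_eq (etrans du d0) v; by rewrite !inE uv.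
have swVA E p : E \in containing ((u, v) |: F) -> p \in VA E ->
    [/\ switchable E u v p.1 p.2, p \notin F & (p.2, p.1) \notin F].
  rewrite inE subUset sub1set => /andP[rE /andP[uvE FE]].
  case: p => x y; rewrite !inE !negb_or /= => /andP[/andP[/andP[/andP[pF prF] p1] p2] xy].
  move: p1 p2; rewrite xy /= !negb_or => /andP[nxu ux] /andP[nyv vy].
  split=> //; first by rewrite /switchable uvE xy (eq_sym u) nxu (eq_sym v) nyv ux vy.
  by apply: contra prF => yxF; apply/imsetP; exists (y, x).
suff : #|containing ((u, v) |: F)| * lo <= #|containing F| * (d * d).
  move=> h; rewrite -(leq_pmul2r d0).
  have le : n * d <= 2 * lo by rewrite /lo; lia.
  rewrite -mulnA; apply: leq_trans (leq_mul (leqnn _) le) _.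
  rewrite mulnCA -[X in _ <= X]mulnA -[2 * d * d]mulnA [X in _ <= X]mulnCA.
  by rewrite leq_mul2l h.
apply: (@double_count _ _ _ _ (fun E p => switch E u v p.1 p.2) VA VB).
- move=> E; rewrite inE => /andP[rE _]; rewrite /VA cardsD (card_regular rE).
  apply: leq_sub2l; apply: leq_trans (subset_leq_card (subsetIr _ _)) _.
  apply: leq_trans (leq_card_setU _ _) _; rewrite card_heads //.
  apply: leq_trans (leq_add (leq_card_setU _ _) (leqnn _)) _; rewrite card_tails //.
  apply: leq_trans (leq_add (leq_add (leq_card_setU _ _) (leqnn _)) (leqnn _)) _.
  rewrite !mul2n -!addnn addnA; apply: leq_add; last first.
    by rewrite leq_mul2r card_closed_nbhd ?orbT.
  apply: leq_add; last by rewrite leq_mul2r card_closed_nbhd ?orbT.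
  by rewrite leq_add2l leq_imset_card.
- move=> E; rewrite inE => /andP[/regularP[_ dE] _]; rewrite /VB.
  rewrite (_ : [set p | _] = setX [set x | (u, x) \in E] [set y | (v, y) \in E]).
    by rewrite cardsX !dE.
  by apply/setP => p; rewrite !inE.
- move=> E [x y] cE pV; have [sw pF rpF] := swVA E _ cE pV.
  move: cE; rewrite inE subUset => /andP[rE /andP[_ FE]]; split.
    rewrite inE switch_regular //=; apply/subsetP => q qF; rewrite !inE (subsetP FE) // andbT.
    apply/orP; left; rewrite !negb_or /=.
    by apply/andP; split; [apply/andP; split; [apply/andP; split|]|];
      apply: contraTneq qF => ->.
  by rewrite inE /= !inE !eqxx !orbT.
- move=> E E' p cE cE' pV pV' eq.
  have [sw _ _] := swVA E _ cE pV; have [sw' _ _] := swVA E' _ cE' pV'.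
  move: cE cE'; rewrite !inE => /andP[/andP[sE _] _] /andP[/andP[sE' _] _].
  by rewrite -(switchK sE sw) -(switchK sE' sw') eq.
Qed.

(** Ordered pairs list each edge once, so [F] never holds the reversal of the arc being added. *)
Lemma containing_bound F : (forall p, p \in F -> p.1 < p.2) ->
  4 * #|F| + 4 * (d.+1 * d) <= n * d ->
  #|containing F| * n ^ #|F| <= #|regular_graphs n d| * (2 * d) ^ #|F|.
Proof.
elim/set_ind: F => [|[u v] F uvF IH] ord big.
  by rewrite cards0 !expn0 !muln1; apply: subset_leq_card; apply/subsetP => E; rewrite inE => /andP[].
have uv : u < v by apply: (ord (u, v)); rewrite setU11.
have big' : 4 * #|F| + 4 * (d.+1 * d) <= n * d.
  by apply: leq_trans big; rewrite leq_add2r leq_mul2l cardsU1 leq_addl.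
have ordF p : p \in F -> p.1 < p.2 by move=> pF; apply: ord; rewrite inE pF orbT.
have nuv : u != v by apply: contraTneq uv => ->; rewrite ltnn.
have vuF : (v, u) \notin F by apply/negP => /ordF /=; rewrite ltnNge ltnW.
have st := containing_step nuv uvF vuF big'.
rewrite cardsU1 uvF add1n !expnS mulnA; apply: leq_trans (leq_mul st (leqnn _)) _.
by rewrite mulnAC [X in _ <= _ * X]mulnC [X in _ <= X]mulnA leq_mul2r IH // orbT.
Qed.

End Switching.

(** * Edges inside a fixed vertex set *)

Section Independent.
Variables (n d : nat) (S : {set 'I_n}).
Implicit Types (E : graphT n).

Definition arcs_in E := [set p in E | (p.1 \in S) && (p.2 \in S)].

(* An edge inside [S] is counted as two arcs. *)
Definition layer j := [set E in regular_graphs n d | #|arcs_in E| == 2 * j].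

Definition leaving E := [set p in E | (p.1 \in S) && (p.2 \notin S)].

Lemma card_leaving E : E \in regular_graphs n d -> #|leaving E| = #|S| * d - #|arcs_in E|.
Proof.
move=> rE; rewrite -(card_tails S rE) -(cardsID [set p | p.2 \in S] [set p in E | p.1 \in S]).
rewrite (_ : _ :&: _ = arcs_in E); last by apply/setP => p; rewrite !inE -andbA.
rewrite addKn; apply: eq_card => p; rewrite !inE.
by case: (p \in E); case: (p.1 \in S); case: (p.2 \in S).
Qed.

(** Two edges [ab], [ce] leaving [S] at [a] and [c] become [ac] inside and [be] outside [S]. There
    are [m] leaving arcs for the first and, after excluding the two neighbourhoods, at least m -
    2(d+1)d for the second. The reverse move picks one of 2(j+1) arcs inside [S] and any of the nd
    arcs. *)
Lemma layer_step j : 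
  let m := #|S| * d - 2 * j in
  #|layer j| * (m * (m - 2 * (d.+1 * d))) <= #|layer j.+1| * (2 * j.+1 * (n * d)).
Proof.
move=> /=; set m := #|S| * d - 2 * j; pose nb E w := w |: [set x | (w, x) \in E].
pose V E (p : 'I_n * 'I_n) := leaving E :\:
  ([set q in E | q.1 \in nb E p.1] :|: [set q in E | q.2 \in nb E p.2]).
pose VA E := [set q | (q.1 \in leaving E) && (q.2 \in V E q.1)].
pose VB E := [set q : ('I_n * 'I_n) * ('I_n * 'I_n) |
  ((q.1.1, q.2.1) \in arcs_in E) && ((q.1.2, q.2.2) \in E)].
have VAE E a b c e : E \in layer j -> ((a, b), (c, e)) \in VA E ->
    [/\ switchable E a b c e, a \in S, b \notin S, c \in S & e \notin S].
  rewrite !inE /= !negb_or => rE /andP[/and3P[ab aS bS]].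
  case/andP=> /andP[]; rewrite !negb_and !negb_or => h1 h2 /and3P[ce cS eS]; split=> //.
  move: h1 h2; rewrite ce /= => /andP[nca ac] /andP[neb be].
  by rewrite /switchable ab ce (eq_sym a) nca (eq_sym b) neb ac.
apply: (@double_count _ _ _ _ (fun E q => switch E q.1.1 q.1.2 q.2.1 q.2.2) VA VB).
- move=> E; rewrite inE => /andP[rE /eqP oE].
  have cm : #|leaving E| = m by rewrite card_leaving // oE.
  rewrite /VA card_dep_pairs -{1}cm -sum_nat_const; apply: leq_sum => p _.
  rewrite /V cardsD cm; apply: leq_sub2l.
  apply: leq_trans (subset_leq_card (subsetIr _ _)) _.
  apply: leq_trans (leq_card_setU _ _) _; rewrite (card_heads _ rE) (card_tails _ rE).
  by rewrite mul2n -addnn leq_add // leq_mul2r (card_closed_nbhd _ rE) orbT.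
- move=> E; rewrite inE => /andP[rE /eqP oE].
  pose g (q : ('I_n * 'I_n) * ('I_n * 'I_n)) := ((q.1.1, q.2.1), (q.1.2, q.2.2)).
  have gI : injective g by move=> [[a b] [c e]] [[a' b'] [c' e']] [-> -> -> ->].
  rewrite -(card_imset _ gI) -oE -(card_regular rE) -cardsX; apply: subset_leq_card.
  by apply/subsetP => _ /imsetP[q + ->]; rewrite inE => h; rewrite inE /= h.
- move=> E [[a b] [c e]] lE qV; have [sw aS bS cS eS] := VAE _ _ _ _ _ lE qV.
  move: lE; rewrite inE => /andP[rE /eqP oE] /=.
  have /and5P[ab ce nac nbe /andP[xac xbe]] := sw.
  have /regularP[/simpleP[sy _] _] := rE.
  split; last by rewrite !inE /= !eqxx aS cS !orbT.
  rewrite inE switch_regular //= mulnS -oE.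
  have -> : arcs_in (switch E a b c e) = (a, c) |: ((c, a) |: arcs_in E).
    apply/setP => -[x y]; rewrite !inE !xpair_eqE /=.
    have F u v : u \in S -> v \notin S -> (u == v) = false.
      by move=> uS vS; apply: contraNF vS => /eqP <-.
    have G u v : u \in S -> (v \in S) = false -> (v == u) = false.
      by move=> uS vS; apply: contraFF vS => /eqP ->.
    case xS: (x \in S); case yS: (y \in S); rewrite ?andbT ?andbF ?orbF.
    + rewrite (F x b) // (F x e) // (F y b) // (F y e) //.
      by case: (x == a); case: (x == c); case: (y == a); case: (y == c); case: ((x, y) \in E).
    + by rewrite (G a y) // (G c y) // !andbF.
    + by rewrite (G a x) // (G c x).
    + by rewrite (G a x) // (G c x).
  by rewrite !cardsU1 !inE /= xpair_eqE (negbTE nac) (sy c a) (negbTE xac).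
- move=> E E' [[a b] [c e]] lE lE' qV qV' /= eq.
  have [sw _ _ _ _] := VAE _ _ _ _ _ lE qV; have [sw' _ _ _ _] := VAE _ _ _ _ _ lE' qV'.
  move: lE lE'; rewrite !inE => /andP[/andP[sE _] _] /andP[/andP[sE' _] _].
  by rewrite -(switchK sE sw) -(switchK sE' sw') eq.
Qed.

(** Product of the first [J] steps; the number of leaving arcs at level [J] serves as a lower bound
    at every level. *)
Lemma independent_bound J : let m := #|S| * d - 2 * J in
  #|layer 0| * (m * (m - 2 * (d.+1 * d))) ^ J <= #|regular_graphs n d| * (J`! * (2 * (n * d)) ^ J).
Proof.
move=> /=; set m := #|S| * d - 2 * J; set W := m * _.
suff h j : j <= J -> #|layer 0| * W ^ j <= #|layer j| * (j`! * (2 * (n * d)) ^ j).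
  apply: leq_trans (h J (leqnn _)) _; rewrite leq_mul2r; apply/orP; right.
  by apply: subset_leq_card; apply/subsetP => E; rewrite inE => /andP[].
elim: j => [|j IH] jJ; first by rewrite !expn0 !muln1.
have mj : m <= #|S| * d - 2 * j by rewrite leq_sub2l // leq_mul2l ltnW.
have Wj : W <= (#|S| * d - 2 * j) * (#|S| * d - 2 * j - 2 * (d.+1 * d)).
  by rewrite leq_mul // leq_sub2r.
rewrite expnSr mulnA; apply: leq_trans (leq_mul (IH (ltnW jJ)) (leqnn W)) _.
rewrite mulnAC; apply: leq_trans (leq_mul (leq_mul (leqnn _) Wj) (leqnn _)) _.
apply: leq_trans (leq_mul (layer_step j) (leqnn _)) _.
rewrite -mulnA leq_mul2l; apply/orP; right; rewrite factS expnSr.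
by rewrite eq_leq //; lia.
Qed.

End Independent.

(** * Elementary inequalities *)

Section Elementary.
Local Open Scope R_scope.

Lemma INR_mul a b : INR (a * b)%N = INR a * INR b.
Proof. exact: mult_INR. Qed.

Lemma INR_add a b : INR (a + b)%N = INR a + INR b.
Proof. exact: plus_INR. Qed.

Lemma INR_exp a b : INR (a ^ b)%N = INR a ^ b.
Proof. by elim: b => [|b IH] //; rewrite expnS INR_mul IH. Qed.

Lemma leq_INR a b : (a <= b)%N -> INR a <= INR b.
Proof. by move=> /leP; apply: le_INR. Qed.

Lemma le_INR_nat a b : INR a <= INR b -> (a <= b)%N.
Proof. by move=> h; apply/leP; apply: INR_le. Qed.

Lemma INR_gt0 a : (0 < a)%N -> 0 < INR a.
Proof. by move=> h; apply: lt_0_INR; apply/ltP. Qed.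

Lemma exp_pow x k : exp x ^ k = exp (INR k * x).
Proof.
elim: k => [|k IH]; first by rewrite /= Rmult_0_l exp_0.
by rewrite S_INR /= IH -exp_plus; congr exp; ring.
Qed.

Lemma succ_pow_le_exp k : INR k.+1 ^ k <= exp 1 * INR k ^ k.
Proof.
case: k => [|k]; first by rewrite /=; have := exp_ineq1_le 1; lra.
have k0 : 0 < INR k.+1 by apply: INR_gt0.
have h : INR k.+2 <= INR k.+1 * exp (/ INR k.+1).
  have := exp_ineq1_le (/ INR k.+1); rewrite [INR k.+2]S_INR => h.
  have -> : INR k.+1 + 1 = INR k.+1 * (1 + / INR k.+1) by field; lra.
  by apply: Rmult_le_compat_l; lra.
apply: Rle_trans (pow_incr _ _ k.+1 (conj _ h)) _; first exact: pos_INR.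
rewrite Rpow_mult_distr exp_pow Rinv_r; last by lra.
by rewrite Rmult_comm; lra.
Qed.

(** The lower half of Stirling's estimate, used for binomial coefficients; the upper half
    [fact_exp_le] loses a factor linear in [k]. *)
Lemma pow_le_exp_fact k : INR k ^ k <= exp (INR k) * INR k`!.
Proof.
elim: k => [|k IH]; first by rewrite /= exp_0; lra.
rewrite factS INR_mul [exp _](_ : _ = exp 1 * exp (INR k)); last first.
  by rewrite S_INR -exp_plus Rplus_comm.
have -> : INR k.+1 ^ k.+1 = INR k.+1 * INR k.+1 ^ k by [].
have h0 : 0 <= INR k.+1 by apply: pos_INR.
apply: Rle_trans (Rmult_le_compat_l _ _ _ h0 (succ_pow_le_exp k)) _.
have := Rmult_le_compat_l (exp 1 * INR k.+1) _ _ _ IH.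
have := exp_pos 1 => e0 h; have : 0 <= exp 1 * INR k.+1 by apply: Rmult_le_pos; lra.
by move/h; lra.
Qed.

Lemma pow_le_fact k : (k ^ k <= 3 ^ k * k`!)%N.
Proof.
apply: le_INR_nat; rewrite INR_mul !INR_exp; apply: Rle_trans (pow_le_exp_fact k) _.
apply: Rmult_le_compat_r; first exact: pos_INR.
have -> : exp (INR k) = exp 1 ^ k by rewrite exp_pow Rmult_1_r.
by apply: pow_incr; split; [have := exp_pos 1; lra | have := exp_le_3; rewrite /=; lra].
Qed.

Lemma exp_pow_le_succ k : exp 1 * INR k ^ k.+1 <= INR k.+1 ^ k.+1.
Proof.
have k0 : 0 < INR k.+1 by apply: INR_gt0.
have h : INR k <= INR k.+1 * exp (- / INR k.+1).
  have := exp_ineq1_le (- / INR k.+1) => h.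
  have -> : INR k = INR k.+1 * (1 + - / INR k.+1) by rewrite S_INR; field; rewrite -S_INR; lra.
  by apply: Rmult_le_compat_l; lra.
have := pow_incr _ _ k.+1 (conj (pos_INR k) h).
rewrite Rpow_mult_distr exp_pow => h2.
have e1 : exp (INR k.+1 * - / INR k.+1) * exp 1 = 1.
  by rewrite -exp_plus -[RHS]exp_0; congr exp; field; lra.
have e0 := exp_pos 1.
have := Rmult_le_compat_l _ _ _ (Rlt_le _ _ e0) h2.
move=> h3; apply: Rle_trans h3 _.
rewrite -Rmult_assoc (Rmult_comm (exp 1)) Rmult_assoc (Rmult_comm (exp 1)) e1; lra.
Qed.

Lemma fact_exp_le k : (0 < k)%N -> INR k`! * exp (INR k) <= exp 1 * INR k * INR k ^ k.
Proof.
case: k => // k _; elim: k => [|k IH].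
  by rewrite /= !Rmult_1_r Rmult_1_l; lra.
rewrite factS INR_mul [exp (INR _)](_ : _ = exp 1 * exp (INR k.+1)); last first.
  by rewrite [INR k.+2]S_INR -exp_plus Rplus_comm.
have k0 : 0 <= INR k.+2 by apply: pos_INR.
have e0 := exp_pos 1.
have h1 := Rmult_le_compat_l _ _ _ (Rmult_le_pos _ _ (Rlt_le _ _ e0) k0) IH.
have h2 := Rmult_le_compat_l _ _ _ (Rmult_le_pos _ _ (Rlt_le _ _ e0) k0) (exp_pow_le_succ k.+1).
have -> : INR k.+2 * INR (k.+1)`! * (exp 1 * exp (INR k.+1)) =
  exp 1 * INR k.+2 * (INR (k.+1)`! * exp (INR k.+1)) by ring.
apply: Rle_trans h1 _; apply: Rle_trans h2.
have -> : INR k.+1 ^ k.+2 = INR k.+1 * INR k.+1 ^ k.+1 by [].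
by apply: Req_le; ring.
Qed.

(* The hypothesis [4 c ln d <= d] makes [J + 1 >= s ln d]. *)
Lemma fact_pow_le d s c : (0 < c)%N -> (0 < d)%N -> 4 * INR c * ln (INR d) <= INR d ->
  let J := (d * s) %/ (4 * c) in (0 < J)%N -> (J`! * d ^ s <= 9 * J * J ^ J)%N.
Proof.
move=> c0 d0 hc J J0.
have lt : (d * s < J.+1 * (4 * c))%N by apply: ltn_ceil; rewrite muln_gt0.
have hJ : INR s * ln (INR d) <= INR J.+1.
  have := leq_INR (ltnW lt); rewrite !INR_mul => h.
  have c0' := INR_gt0 c0; have s0 := pos_INR s.
  have : INR s * (4 * INR c * ln (INR d)) <= INR s * INR d by apply: Rmult_le_compat_l.
  have e4 : INR 4 = 4 by rewrite /=; lra.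
  move=> h2; apply: (Rmult_le_reg_l (4 * INR c)); first by lra.
  move: h; rewrite e4; lra.
apply: le_INR_nat; rewrite !INR_mul !INR_exp.
have ds : INR d ^ s <= exp 1 * exp (INR J).
  have -> : INR d ^ s = exp (INR s * ln (INR d)).
    by rewrite -exp_pow exp_ln //; apply: INR_gt0.
  rewrite -exp_plus -[1 + _]Rplus_comm -S_INR.
  case: hJ => [hlt|->]; [exact/Rlt_le/exp_increasing | exact: Rle_refl].
have f0 := pos_INR J`!; have J0' := pos_INR J.
apply: Rle_trans (Rmult_le_compat_l _ _ _ f0 ds) _.
have e0 := exp_pos 1; have e3 := exp_le_3.
have h := Rmult_le_compat_l _ _ _ (Rlt_le _ _ e0) (fact_exp_le J0).
apply: Rle_trans (_ : exp 1 * (exp 1 * INR J * INR J ^ J) <= _); first by lra.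
have -> : INR 9 = 9 by rewrite /=; lra.
have p0 : 0 <= INR J * INR J ^ J by apply: Rmult_le_pos => //; apply: pow_le.
have e9 : exp 1 * exp 1 <= 9 by nra.
have := Rmult_le_compat_r _ _ _ p0 e9; lra.
Qed.

End Elementary.

Lemma bin_pow_le n s : 'C(n, s) * s ^ s <= (3 * n) ^ s.
Proof.
apply: leq_trans (leq_mul (leqnn _) (pow_le_fact s)) _.
rewrite mulnCA expnMn leq_mul2l; apply/orP; right; rewrite bin_ffact.
elim: s n => // s IH [|n]; first by rewrite ffact0n.
rewrite ffactnS expnS leq_mul2l; apply/orP; right => /=.
by apply: leq_trans (IH _) _; case: s {IH} => // s; rewrite leq_exp2r // leqnSn.
Qed.

Lemma pow3_le_pow2 s : 10 <= s -> s ^ 3 <= 2 ^ s.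
Proof.
elim: s => // s IH; rewrite leq_eqVlt => /orP[/eqP <- //|].
rewrite ltnS => hs; have := IH hs; rewrite [2 ^ s.+1]expnS; set a := 2 ^ s => h.
apply: leq_trans (leq_mul (leqnn 2) h); rewrite !expnS !expn0; nia.
Qed.

Lemma mul_pow2_le s : s * 2 ^ s <= 4 ^ s.
Proof. by rewrite (expnMn 2 2) leq_mul2r ltnW ?orbT // ltn_expl. Qed.

(** * Union bounds *)

Lemma card_bigcup_le (I T : finType) (P : pred I) (A : I -> {set T}) x b :
  (forall i, P i -> #|A i| * x <= b) -> #|\bigcup_(i | P i) A i| * x <= #|[set i | P i]| * b.
Proof.
move=> h; have -> : #|[set i | P i]| * b = \sum_(i | P i) b.
  by rewrite -sum_nat_const; apply: eq_bigl => i; rewrite inE.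
apply: (@leq_trans (\sum_(i | P i) #|A i| * x)); last exact: leq_sum.
elim/big_rec2: _ => [|i m B _ le]; first by rewrite cards0.
apply: leq_trans (leq_mul (leq_card_setU _ _) (leqnn x)) _.
by rewrite mulnDl leq_add2l.
Qed.

Section SparseCount.
Variables (n d : nat).
Hypothesis d10 : 10 <= d.
Let q := 20 * d + 10.
Let L := d ^ (4 * q + 2).
Implicit Types (E : graphT n) (S : {set 'I_n}).

Definition dense_at s := [set E in regular_graphs n d |
  [exists S : {set 'I_n}, (#|S| == s) && ((20 * d + 11) * #|S| < (20 * d + 10) * inner E S)]].

Definition pairs_in S := [set p : 'I_n * 'I_n | [&& p.1 \in S, p.2 \in S & p.1 < p.2]].

Lemma inner_pairs E S : inner E S = #|E :&: pairs_in S|.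
Proof.
rewrite -sum1_card; under [RHS]eq_bigl do rewrite !inE.
rewrite /inner pair_big_dep /= big_mkcond [RHS]big_mkcond; apply: eq_bigr => -[u v] _ /=.
by rewrite /adj; case: (u \in S); case: (v \in S); case: (_ \in E); case: (u < v).
Qed.

Lemma card_pairs_in S : #|pairs_in S| <= #|S| * #|S|.
Proof.
rewrite -cardsX; apply: subset_leq_card; apply/subsetP => p.
by rewrite !inE => /and3P[-> -> _].
Qed.

(** Here [m] is the least integer above (1+1/q)s. A dense set contains [m] edges, and the union
    bound runs over the vertex set and over the choice of these edges. *)
Lemma dense_at_bound s : let m := s + (s %/ q).+1 in
  4 * m + 4 * (d.+1 * d) <= n * d ->
  #|dense_at s| * n ^ m <= 'C(n, s) * ('C(s * s, m) * (#|regular_graphs n d| * (2 * d) ^ m)).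
Proof.
move=> m big.
pose A S := \bigcup_(F : {set 'I_n * 'I_n} | (F \subset pairs_in S) && (#|F| == m)) containing d F.
have sub : dense_at s \subset \bigcup_(S : {set 'I_n} | #|S| == s) A S.
  apply/subsetP => E; rewrite inE => /andP[rE /existsP[S /andP[cS dS]]].
  apply/bigcupP; exists S => //.
  have le : m <= #|E :&: pairs_in S|.
    rewrite -inner_pairs leqNgt /m addnS ltnS; apply/negP => lt.
    move: dS; rewrite (eqP cS) ltnNge => /negP; apply.
    have := leq_trunc_div s q; rewrite -/q => h.
    have := leq_mul (leqnn q) lt; rewrite mulnDr (mulnC q (_ %/ _)) => h2.
    by rewrite (_ : 20 * d + 11 = q.+1) ?mulSn; [lia | rewrite /q; lia].
  have [F sF cF] := subset_of_card le.
  apply/bigcupP; exists F.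
    by rewrite cF eqxx (subset_trans sF (subsetIr _ _)).
  by rewrite inE rE (subset_trans sF (subsetIl _ _)).
apply: leq_trans (leq_mul (subset_leq_card sub) (leqnn _)) _.
rewrite -[n in 'C(n, s)]card_ord -card_draws.
apply: card_bigcup_le => S /eqP cS.
apply: (@leq_trans ('C(#|pairs_in S|, m) * (#|regular_graphs n d| * (2 * d) ^ m))); last first.
  by rewrite leq_mul2r leq_bin2l ?orbT // -cS card_pairs_in.
rewrite -cards_draws; apply: card_bigcup_le => F /andP[sF /eqP cF].
rewrite -cF; apply: containing_bound; last by rewrite cF.
by move=> p /(subsetP sF); rewrite inE => /and3P[].
Qed.

(** Beyond the [s] edges that pay for choosing the vertex set, each of the [j] surplus edges gains a
    factor Ls/n. Since Ls <= n, all but one of these factors are dropped, which leaves 1/n. *)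
Lemma dense_at_count s : 0 < s -> s * L <= n ->
  #|dense_at s| * n * 2 ^ s <= L * #|regular_graphs n d|.
Proof.
move=> s0 sL; pose j := (s %/ q).+1; pose m := s + j.
have q0 : 0 < q by rewrite /q; lia.
have sqj : s <= q * j by rewrite mulnC ltnW // ltn_ceil.
have jm : j <= s.+1 by rewrite /j ltnS leq_div.
have d0 : 0 < d by apply: leq_trans d10.
have L100 : d ^ 4 <= L by rewrite /L leq_pexp2l // /q; lia.
have big : 4 * m + 4 * (d.+1 * d) <= n * d.
  have h1 : s * d ^ 4 <= n by apply: leq_trans sL; rewrite leq_mul2l L100 orbT.
  have h2 : s * d ^ 4 * d <= n * d by rewrite leq_mul2r h1 orbT.
  apply: leq_trans h2; rewrite /m.
  have h3 : d * 1000 <= d ^ 4 by rewrite expnS leq_mul2l (@leq_exp2r 10 d 3) // d10 orbT.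
  have : s * (d * 1000) * d <= s * d ^ 4 * d by rewrite leq_mul2r leq_mul2l h3 !orbT.
  move: jm d10 s0; clear; nia.
have n0 : 0 < n by apply: leq_trans sL; rewrite muln_gt0 s0 expn_gt0 d0.
set RG := #|regular_graphs n d|; set B := #|dense_at s|.
have h0 : B * n ^ m <= 'C(n, s) * ('C(s * s, m) * (RG * (2 * d) ^ m)) := dense_at_bound big.
have hb2 : 'C(s * s, m) <= (3 * s) ^ m.
  rewrite -(@leq_pmul2r (s ^ m)) ?expn_gt0 ?s0 //.
  apply: (@leq_trans ('C(s * s, m) * m ^ m)).
    by rewrite leq_mul2l leq_exp2r ?leq_addr ?orbT // /m /j addnS.
  by apply: leq_trans (bin_pow_le _ _) _; rewrite -expnMn mulnA.
have h1 : B * n ^ m * s ^ s <= (3 * n) ^ s * ((3 * s) ^ m * (RG * (2 * d) ^ m)).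
  apply: leq_trans (leq_mul h0 (leqnn _)) _; rewrite mulnAC.
  by apply: leq_mul (bin_pow_le _ _) _; rewrite leq_mul2r hb2 orbT.
have h2 : B * n ^ j <= (18 * d) ^ s * (6 * d * s) ^ j * RG.
  have ns0 : 0 < n ^ s * s ^ s by rewrite muln_gt0 !expn_gt0 n0 s0.
  rewrite -(leq_pmul2r ns0); move: h1; rewrite /m !expnD !expnMn.
  rewrite [18](_ : _ = 3 * 3 * 2) // [6](_ : _ = 3 * 2) // !expnMn.
  by apply: etrans; congr (_ <= _); lia.
have h3 : B * n ^ j * d ^ s <= (L * s) ^ j * RG.
  apply: leq_trans (leq_mul h2 (leqnn _)) _; rewrite mulnAC leq_mul2r; apply/orP; right.
  (* An additional d^s is absorbed into [L] by s <= qj; it pays for the factor s 2^s that makes the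
     bound summable over [s]. *)
  have e1 : (18 * d) ^ s * d ^ s <= d ^ (4 * q * j).
    rewrite -expnMn; apply: (@leq_trans ((d ^ 4) ^ s)).
      by rewrite leq_exp2r // !expnS expn0; move: d10; clear; nia.
    by rewrite -expnM leq_pexp2l // -mulnA leq_mul2l sqj orbT.
  have e2 : (6 * d * s) ^ j <= (d ^ 2 * s) ^ j.
    by rewrite leq_exp2r // leq_mul2r !expnS expn0; move: d10; clear; nia.
  rewrite mulnAC; apply: leq_trans (leq_mul e1 e2) _.
  by rewrite /L expnD !expnMn -!expnM mulnA.
have h4 : B * n * d ^ s <= L * s * RG.
  have nj0 : 0 < n ^ (s %/ q) by rewrite expn_gt0 n0.
  rewrite -(leq_pmul2r nj0); apply: (@leq_trans ((L * s) ^ j * RG)).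
    by apply: leq_trans h3; rewrite /j expnS; apply: eq_leq; lia.
  rewrite /j expnS mulnAC leq_mul2l; apply/orP; right.
  have : (L * s) ^ (s %/ q) <= n ^ (s %/ q).
    by case: (s %/ q) => // t; rewrite leq_exp2r // mulnC.
  done.
rewrite -(leq_pmul2r s0); apply: leq_trans (_ : B * n * d ^ s <= _).
  rewrite -mulnA leq_mul2l [_ * s]mulnC; apply/orP; right.
  apply: leq_trans (mul_pow2_le s) _; rewrite leq_exp2r //.
  exact: leq_trans d10.
by apply: leq_trans h4 _; rewrite mulnAC.
Qed.

Definition dense_graphs := [set E in regular_graphs n d | [exists S : {set 'I_n},
  (#|S| * L <= n) && ((20 * d + 11) * #|S| < (20 * d + 10) * inner E S)]].

Lemma dense_graphs_count : #|dense_graphs| * n <= L * #|regular_graphs n d|.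
Proof.
have d0 : 0 < d by apply: leq_trans d10.
have sub : dense_graphs \subset \bigcup_(s < n.+1 | (0 < s) && (s * L <= n)) dense_at s.
  apply/subsetP => E; rewrite inE => /andP[rE /existsP[S /andP[cS dS]]].
  have ltS : #|S| < n.+1 by rewrite ltnS -[n in X in _ <= X]card_ord max_card.
  apply/bigcupP; exists (Ordinal ltS) => /=.
    rewrite cS andbT lt0n cards_eq0; apply: contraTneq dS => ->.
    by rewrite inner0 muln0.
  by rewrite inE rE; apply/existsP; exists S; rewrite eqxx.
(* Multiplying by 2^n keeps the geometric series of the 2^(-s) in the naturals. *)
rewrite -(@leq_pmul2r (2 ^ n)) ?expn_gt0 //.
apply: (@leq_trans (\sum_(s < n.+1 | (0 < s) && (s * L <= n)) #|dense_at s| * n * 2 ^ n)).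
  apply: leq_trans (leq_mul (leq_mul (subset_leq_card sub) (leqnn _)) (leqnn _)) _.
  elim/big_rec2: _ => [|i a B _ le]; first by rewrite cards0.
  rewrite -mulnA; apply: leq_trans (leq_mul (leq_card_setU _ _) (leqnn _)) _.
  by rewrite mulnDl !mulnA leq_add2l.
apply: (@leq_trans (\sum_(s < n.+1 | 0 < s) L * #|regular_graphs n d| * 2 ^ (n - s))).
  rewrite big_mkcondr; apply: leq_sum => s s0; case: ifP => // sL.
  rewrite -[n in 2 ^ n](@subnKC s); last by rewrite -ltnS ltn_ord.
  by rewrite expnD mulnA leq_mul2r dense_at_count ?orbT.
rewrite -big_distrr leq_mul2l /=; apply/orP; right.
rewrite big_mkcond big_ord_recl /= add0n.
rewrite (eq_bigr (fun i : 'I_n => 2 ^ (n - i.+1))) //.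
rewrite -(big_mkord xpredT (fun i => 2 ^ (n - i.+1))) big_nat_rev /= add0n.
rewrite (eq_big_nat _ _ (F2 := fun i => 2 ^ i)) => [|i /andP[_ lt]]; last by congr (2 ^ _); lia.
elim: {sub} n => [|k IH]; first by rewrite big_geq.
by rewrite big_nat_recr //= expnS mul2n -addnn leq_add2r.
Qed.

End SparseCount.

(** * Independent sets of linear size *)

Section IndependentCount.
Variables (n d s c : nat).
Let J := (d * s) %/ (4 * c).
Hypotheses (c2 : 2 <= c) (ns : n <= c * s) (s24 : 24 * d.+1 <= s) (c6 : 6 * c <= d).
Hypothesis JJ : 0 < J -> J`! * d ^ s <= 9 * J * J ^ J.
Implicit Types (E : graphT n) (S : {set 'I_n}).

(** With x = ds, the hypotheses give W >= x^2/2, and 2nd <= 2cx. Each of the [J] switching steps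
    therefore gains at least x/(4c), hence at least [J], apart from the factorial. *)
Lemma independent_set_bound S : #|S| = s ->
  #|layer d S 0| * J ^ J <= #|regular_graphs n d| * J`!.
Proof.
move=> cS; have /= := independent_bound d S J; rewrite cS.
set m := s * d - 2 * J; set W := m * _ => hW; pose x := d * s.
have x0 : 0 < x by rewrite muln_gt0; move: s24 c6 c2; clear; lia.
have J4 : 4 * c * J <= x by rewrite mulnC leq_trunc_div.
have J8 : 8 * J <= x by apply: leq_trans J4; rewrite leq_mul2r; move: c2; clear; lia.
have hm : 3 * x <= 4 * m.
  by rewrite /m mulnC -/x; move: J8; clear; lia.
have hd : 24 * (d.+1 * d) <= x by rewrite mulnA /x mulnC leq_mul2l s24 orbT.
have hm2 : 2 * x <= 3 * (m - 2 * (d.+1 * d)) by move: hm hd; clear; lia.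
have hx : x * x <= 2 * W.
  have := leq_mul hm hm2; rewrite /W; clear; lia.
have h1 : #|layer d S 0| * (x * x) ^ J <= #|regular_graphs n d| * (J`! * (4 * c * x) ^ J).
  apply: (@leq_trans (#|layer d S 0| * W ^ J * 2 ^ J)).
    by rewrite -mulnA -expnMn leq_mul2l (mulnC W); apply/orP; right; case: (J) => // j; rewrite leq_exp2r.
  apply: leq_trans (leq_mul hW (leqnn _)) _.
  rewrite -mulnA leq_mul2l -mulnA -expnMn leq_mul2l; apply/orP; right; apply/orP; right.
  case: (J) => // j; rewrite leq_exp2r // /x.
  have := leq_mul ns (leqnn d); clear; lia.
have xJ : 0 < x ^ J by rewrite expn_gt0 x0.
have h2 : #|layer d S 0| * x ^ J <= #|regular_graphs n d| * (J`! * (4 * c) ^ J).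
  by rewrite -(leq_pmul2r xJ); move: h1; rewrite !expnMn !mulnA.
have cJ : 0 < (4 * c) ^ J by rewrite expn_gt0; move: c2; clear; case: (c).
rewrite -(leq_pmul2r cJ) -mulnA -[X in _ <= X]mulnA; apply: leq_trans h2.
rewrite leq_mul2l -expnMn mulnC; apply/orP; right.
by case: (J) J4 => // j J4; rewrite leq_exp2r.
Qed.

Definition independent_graphs := [set E in regular_graphs n d |
  [exists S : {set 'I_n}, (#|S| == s) && (#|arcs_in S E| == 0)]].

(** There are at most (3c)^s sets, each independent with probability at most 9J/d^s. Since 6c <= d
    this leaves 9J/2^s, and J <= s^2 with s^3 <= 2^s gives 9/s. *)
Lemma independent_graphs_count : #|independent_graphs| * s <= 9 * #|regular_graphs n d|.
Proof.
set RG := #|regular_graphs n d|; set I := #|_|.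
have s0 : 0 < s by move: s24; clear; lia.
have d0 : 0 < d by move: c2 c6; clear; lia.
have c0 : 0 < c by move: c2; clear; lia.
have h1 : I * J ^ J <= 'C(n, s) * (RG * J`!).
  have sub : independent_graphs \subset \bigcup_(S : {set 'I_n} | #|S| == s) layer d S 0.
    apply/subsetP => E; rewrite inE => /andP[rE /existsP[S /andP[cS dS]]].
    by apply/bigcupP; exists S; rewrite // inE rE muln0.
  apply: leq_trans (leq_mul (subset_leq_card sub) (leqnn _)) _.
  rewrite -[n in 'C(n, s)]card_ord -card_draws.
  by apply: card_bigcup_le => S /eqP cS; apply: independent_set_bound.
have h2 : I * J ^ J <= (3 * c) ^ s * (RG * J`!).
  have ss0 : 0 < s ^ s by rewrite expn_gt0 s0.
  rewrite -(leq_pmul2r ss0); apply: leq_trans (leq_mul h1 (leqnn _)) _.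
  rewrite mulnAC [X in _ <= X]mulnAC leq_mul2r; apply/orP; right.
  apply: leq_trans (bin_pow_le _ _) _; rewrite -expnMn leq_exp2r //.
  by rewrite -mulnA leq_mul2l ns.
have J0 : 0 < J.
  rewrite divn_gt0 ?muln_gt0 //; apply: (@leq_trans d); last by rewrite leq_pmulr.
  by move: c6; clear; lia.
have h3 : I * d ^ s <= (3 * c) ^ s * (RG * (9 * J)).
  have JJ0 : 0 < J ^ J by rewrite expn_gt0 J0.
  rewrite -(leq_pmul2r JJ0) mulnAC.
  apply: leq_trans (leq_mul h2 (leqnn _)) _.
  by rewrite -!mulnA leq_mul2l leq_mul2l [9 * _]mulnA JJ ?orbT.
have h4 : I * 2 ^ s <= RG * (9 * J).
  have ds0 : 0 < d ^ s by rewrite expn_gt0 d0.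
  rewrite -(leq_pmul2r ds0) mulnAC; apply: leq_trans (leq_mul h3 (leqnn _)) _.
  rewrite mulnAC mulnC leq_mul2l -expnMn leq_exp2r //; apply/orP; right.
  by move: c6; clear; lia.
have Jss : J <= s * s.
  apply: leq_trans (leq_div _ _) _; rewrite leq_mul2r.
  by move: s24; clear; lia.
have ss0 : 0 < s * s by rewrite muln_gt0 s0.
rewrite -(leq_pmul2r ss0).
apply: (@leq_trans (I * 2 ^ s)).
  rewrite -mulnA leq_mul2l; apply/orP; right; apply: leq_trans (pow3_le_pow2 _).
    by rewrite !expnS expn0 muln1.
  by move: s24; clear; lia.
apply: leq_trans h4 _; rewrite mulnCA -mulnA leq_mul2l /=.
by rewrite leq_mul2l Jss orbT.
Qed.

End IndependentCount.

Lemma colorable_independent n (E : graphT n) c s : colorableb E c -> c * s.-1 < n ->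
  exists2 S : {set 'I_n}, #|S| = s & #|arcs_in S E| = 0.
Proof.
case/existsP=> f /forallP hf lt.
have [i le] : exists i, s <= #|[set u | f u == i]|.
  apply/existsP; apply: contraLR lt; rewrite negb_exists => /forallP h.
  rewrite -leqNgt -[n]card_ord -[#|_|]cardsT.
  have -> : #|[set: 'I_n]| = \sum_(i < c) #|[set u | f u == i]|.
    rewrite -sum1_card (partition_big f xpredT) //=; apply: eq_bigr => i _.
    by rewrite -sum1_card; apply: eq_bigl => u; rewrite !inE.
  rewrite -[c in c * _]card_ord -sum_nat_const; apply: leq_sum => i _.
  by have := h i; rewrite -ltnNge; case: (s).
have [S sS cS] := subset_of_card le; exists S => //; apply: eq_card0 => -[u v].
rewrite !inE /=; apply/negP => /and3P[uv uS vS].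
have /forallP/(_ v) := hf u; rewrite uv /=.
have := subsetP sS u uS; have := subsetP sS v vS; rewrite !inE => /eqP -> /eqP ->.
by rewrite eqxx.
Qed.

(** * Existence of regular graphs *)

Section Circulant.
Variable N : nat.
Local Notation n := N.+1.

(** The residues 1, ..., h and their negatives modulo n, as connection set of a circulant graph. *)
Definition window (h : nat) : {set 'I_n} := [set j : 'I_n | (0 < j <= h) || (n - h <= j)].

Lemma card_window h : 2 * h < n -> #|window h| = 2 * h.
Proof.
elim: h => [|h IH] lt.
  apply: eq_card0 => j; rewrite !inE subn0; have := ltn_ord j; lia.
have lt1 : h.+1 < n by lia.
have lt2 : n - h.+1 < n by lia.
have -> : window h.+1 = Ordinal lt1 |: (Ordinal lt2 |: window h).
  by apply/setP => j; rewrite !inE -!val_eqE /=; have := ltn_ord j; lia.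
rewrite !cardsU1 !inE -!val_eqE /= IH; lia.
Qed.

Lemma regular_of_symmetric (C : {set 'I_n}) : (forall j, (- j \in C)%R = (j \in C)) -> 0%R \notin C ->
  [set p : 'I_n * 'I_n | (p.2 - p.1)%R \in C] \in regular_graphs n #|C|.
Proof.
move=> sC nC; apply/regularP; split.
  apply/simpleP; split=> [u v|u]; rewrite !inE /=; last by rewrite GRing.subrr.
  by rewrite -sC GRing.opprB.
move=> u; rewrite -[RHS](card_imset _ (@GRing.addIr _ u)); apply: eq_card => v; rewrite !inE /=.
apply/idP/imsetP => [h|[j jC ->]]; last by rewrite GRing.addrK.
by exists (v - u)%R; rewrite // GRing.subrK.
Qed.

Lemma regular_exists d : d < n -> ~~ odd (d * n) -> exists E, E \in regular_graphs n d.
Proof.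
move=> ltd ev; have valN (j : 'I_n) : 0 < j -> nat_of_ord (- j)%R = n - j.
  by move=> j0 /=; rewrite modn_small //; lia.
have val0 (j : 'I_n) : 0 < j \/ j = 0%R.
  by case: (posnP j) => [j0|]; [right; apply: val_inj | left].
have sym h j : 2 * h < n -> ((- j)%R \in window h) = (j \in window h).
  move=> lh; case: (val0 j) => [j0|->]; last by rewrite GRing.oppr0.
  by rewrite !inE valN //; have := ltn_ord j; lia.
have n0 h : 2 * h < n -> 0%R \notin window h by move=> lh; rewrite inE /=; lia.
have [h dh] : exists h, d = 2 * h + odd d by exists d./2; lia.
have lh : 2 * h < n by lia.
case od: (odd d) dh => dh; last first.
  have := regular_of_symmetric (fun j => sym h j lh) (n0 h lh).
  by rewrite card_window // dh addn0; eexists; eassumption.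
(* For odd [d] the order n is even, and the self-inverse residue n/2 supplies the missing
   neighbour. *)
have lm : n./2 < n by lia.
have en : 2 * n./2 = n by move: ev; rewrite oddM od /=; lia.
have nm : Ordinal lm \notin window h by rewrite inE /=; lia.
have := @regular_of_symmetric (Ordinal lm |: window h).
have -> : #|Ordinal lm |: window h| = d by rewrite cardsU1 nm card_window // [RHS]dh addnC.
move=> H; eexists; apply: H.
  move=> j; rewrite !in_setU1 sym //; congr (_ || _).
  case: (val0 j) => [j0|->]; last by rewrite GRing.oppr0.
  rewrite -!val_eqE -[val (- j)%R]/(nat_of_ord (- j)%R) valN //.
  by have := ltn_ord j; rewrite /=; lia.
by rewrite in_setU1 negb_or n0 // andbT -val_eqE /=; lia.
Qed.

End Circulant.

(** * The random regular graph *)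

(* [all_algebra] rebinds the key [R] to [ring_scope]. *)
Delimit Scope R_scope with R.

Lemma colorable_mono n (E : graphT n) c c' : c' <= c -> colorableb E c' -> colorableb E c.
Proof.
move=> le /existsP[f /forallP hf]; apply/existsP; exists [ffun u => widen_ord le (f u)].
apply/forallP => u; apply/forallP => v; apply/implyP => uv; rewrite !ffunE.
have /forallP/(_ v) := hf u; rewrite uv /=; apply: contra => /eqP e.
by apply/eqP/val_inj; move/(congr1 val): e.
Qed.

Lemma chromatic_colorable n (E : graphT n) : simpleb E -> colorableb E (chromatic_number E).
Proof.
move=> sE; have ex : exists c, colorableb E c.
  exists n; apply/existsP; exists [ffun u => u]; apply/forallP => u; apply/forallP => v.
  by apply/implyP => uv; rewrite !ffunE; apply: (adj_neq sE).
rewrite /chromatic_number; case: excluded_middle_informative => // h.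
by case: ex_minnP.
Qed.

Section RealBounds.
Local Open Scope R_scope.

Lemma floor_exists x : 0 <= x -> exists c : nat, INR c <= x < INR c + 1.
Proof.
move=> x0; have [m hm] := INR_unbounded x.
pose P c := if Rlt_dec x (INR c) then true else false.
have exP : exists c, P c by exists m; rewrite /P; case: Rlt_dec.
case: (ex_minnP exP) => -[|c]; rewrite {1}/P; case: Rlt_dec => // lt _ hmin.
  by move: lt; rewrite /=; lra.
exists c; rewrite -S_INR; split=> //; apply: Rnot_lt_le => lt'.
have : P c by rewrite /P; case: Rlt_dec.
by move/hmin; rewrite ltnn.
Qed.

Lemma ln_le_compat x y : 0 < x -> x <= y -> ln x <= ln y.
Proof. by move=> x0 [lt|->]; [exact/Rlt_le/ln_increasing | exact: Rle_refl]. Qed.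

Lemma ln_le_third d : (10 <= d)%N -> ln (INR d) <= INR d / 3.
Proof.
move=> d10; have x10 : 10 <= INR d.
  by have := leq_INR d10; rewrite [INR 10]/=; lra.
rewrite -[INR d / 3]ln_exp; apply: ln_le_compat; first by lra.
(* The exponential of d/3 is the fourth power of exp t, at least (1+t)^4 >= (4t)^2, which exceeds
   12t because t >= 10/12. *)
set t := INR d / 12.
have -> : INR d / 3 = INR 4 * t by rewrite /t /=; field.
rewrite -exp_pow.
have e1 : 1 + t <= exp t := exp_ineq1_le t.
have t0 : 10 / 12 <= t by rewrite /t; lra.
have -> : INR d = 12 * t by rewrite /t; field.
apply: Rle_trans (pow_incr (1 + t) _ 4 _); last by lra.
have h : 4 * t <= (1 + t) ^ 2 by have := pow2_ge_0 (1 - t); lra.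
have -> : (1 + t) ^ 4 = (1 + t) ^ 2 * (1 + t) ^ 2 by ring.
have h2 : 4 * t * (4 * t) <= (1 + t) ^ 2 * (1 + t) ^ 2 by apply: Rmult_le_compat; lra.
nra.
Qed.

Lemma two_le_ln d : (10 <= d)%N -> 2 <= ln (INR d).
Proof.
move=> d10; rewrite -[2]ln_exp; apply: ln_le_compat; first exact: exp_pos.
have -> : exp 2 = exp 1 ^ 2 by rewrite exp_pow; congr exp; rewrite /=; ring.
have := leq_INR d10; rewrite [INR 10]/= => h.
have := exp_le_3; have := exp_pos 1; nra.
Qed.

(** The exponent is 160d+84. By ln d <= d/3 its product with ln d is at most (160d+84)d/3, which for
    d >= 10 stays below 6d^3. *)
Lemma pow_le_of_ln n d : (10 <= d)%N -> 6 * INR d ^ 3 <= ln (INR n) -> (0 < n)%N ->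
  (d ^ (2 * (4 * (20 * d + 10) + 2)) <= n)%N.
Proof.
move=> d10 h n0; apply: le_INR_nat; rewrite INR_exp.
have x10 : 10 <= INR d.
  by have := leq_INR d10; rewrite [INR 10]/=; lra.
rewrite -[X in X ^ _]exp_ln; last by lra.
rewrite exp_pow -[INR n]exp_ln; last exact: INR_gt0.
suff : INR (2 * (4 * (20 * d + 10) + 2)) * ln (INR d) <= 6 * INR d ^ 3.
  move=> h2; have : INR (2 * (4 * (20 * d + 10) + 2)) * ln (INR d) <= ln (INR n) by lra.
  by case=> [lt|->]; [exact/Rlt_le/exp_increasing | exact: Rle_refl].
rewrite !(INR_mul, INR_add) [INR 2]/= [INR 4]/= [INR 20](_ : _ = 20); last by rewrite /=; lra.
rewrite [INR 10](_ : _ = 10); last by rewrite /=; lra.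
have l1 := ln_le_third d10; have l2 := two_le_ln d10.
set x := INR d in x10 l1 l2 *; set l := ln x in l1 l2 *.
apply: Rle_trans (_ : (160 * x + 84) * (x / 3) <= _); last by nra.
by nra.
Qed.

End RealBounds.

(** * Probability of the good event at fixed [n] and [d] *)

Section FixedDegree.
Variables n d : nat.
Hypothesis d10 : 10 <= d.
Let L := d ^ (4 * (20 * d + 10) + 2).
Hypothesis LLn : L * L <= n.

Let d0 : 0 < d. Proof. by apply: leq_trans d10. Qed.
Let L0 : 0 < L. Proof. by rewrite expn_gt0 d0. Qed.
Let n0 : 0 < n. Proof. by apply: leq_trans LLn; rewrite muln_gt0 L0. Qed.

Let d5n : d ^ 5 <= n.
Proof.
apply: leq_trans LLn; apply: leq_trans (leq_pmulr _ L0).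
by rewrite /L leq_pexp2l //; lia.
Qed.

Definition low_chromatic := [set E in regular_graphs n d |
  Defs.decP (INR (chromatic_number E) <= chi_threshold d)%R].

(** Let [c] be the floor of the threshold. A [c]-colouring has a colour class of size at least n/c,
    and c <= d/(4 ln d) is exactly the hypothesis of [fact_pow_le]. *)
Lemma low_chromatic_count : #|low_chromatic| * n <= 9 * d * #|regular_graphs n d|.
Proof.
have ln2 := two_le_ln d10; have x0 := INR_gt0 d0.
have thr0 : (0 <= chi_threshold d)%R.
  by apply/Rlt_le/Rdiv_lt_0_compat => //; lra.
have [c [c_le c_lt]] := floor_exists thr0.
have colc E : E \in low_chromatic -> colorableb E c.
  rewrite inE => /andP[/regularP[sE _] /decPP le].
  apply: colorable_mono (chromatic_colorable sE); rewrite -ltnS; apply/ltP/INR_lt.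
  by rewrite S_INR; lra.
have c_ln : (4 * INR c * ln (INR d) <= INR d)%R.
  have := Rmult_le_compat_r (4 * ln (INR d)) _ _ ltac:(lra) c_le.
  rewrite /chi_threshold (_ : _ / _ * _ = INR d)%R; first lra.
  by field; lra.
have c8 : 8 * c <= d.
  apply: le_INR_nat; rewrite INR_mul (_ : INR 8 = 8%R); last by rewrite /=; lra.
  have := pos_INR c; nra.
(* With at most one colour there are no edges, whereas [d] is positive. *)
case: (leqP c 1) => c1.
  rewrite (_ : low_chromatic = set0) ?cards0 //; apply/setP => E; rewrite in_set0; apply/negP => lowE.
  have := colc E lowE; move/(colorable_mono c1) => /existsP[f /forallP hf].
  move: lowE; rewrite inE => /andP[/regularP[_ dE] _].
  have := dE (Ordinal n0) => cE.
  have : 0 < #|[set v | (Ordinal n0, v) \in E]| by rewrite cE.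
  case/card_gt0P => v; rewrite inE => uv.
  have /forallP/(_ v) := hf (Ordinal n0); rewrite uv /= => /eqP; apply.
  by apply: val_inj; have := ltn_ord (f (Ordinal n0)); have := ltn_ord (f v); rewrite /=; lia.
(* The ceiling of n/c: both n <= cs and c(s-1) < n are used. *)
pose s := (n + c.-1) %/ c.
have c0 : 0 < c by apply: ltnW.
have sc1 : s * c <= n + c.-1 by apply: leq_trunc_div.
have sc2 : n + c.-1 < s.+1 * c by apply: ltn_ceil.
have ns : n <= c * s by rewrite mulnC; move: sc2 c0; clear; rewrite mulSn; lia.
have s4 : d ^ 4 <= s.
  rewrite -(leq_pmul2l d0) -expnS; apply: leq_trans d5n _; apply: leq_trans ns _.
  by rewrite leq_mul2r; apply/orP; right; move: c8; clear; lia.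
have s24 : 24 * d.+1 <= s.
  apply: leq_trans s4; rewrite !expnS expn0 muln1; move: d10; clear => h.
  have h1 : 10 * 10 <= d * d by apply: leq_mul.
  have := leq_mul h1 (leqnn (d * d)); have := leq_mul h (leqnn d); lia.
have sub : low_chromatic \subset independent_graphs n d s.
  apply/subsetP => E lE; have colE := colc E lE; move: lE; rewrite !inE => /andP[-> _] /=.
  have lt : c * s.-1 < n by move: sc1 c0 n0; clear; case: (s) => [|t]; rewrite ?muln0 ?mulSn /=; lia.
  have [S cS aS] := colorable_independent colE lt.
  by apply/existsP; exists S; rewrite cS aS !eqxx.
have JJ := @fact_pow_le d s c c0 d0 c_ln.
have cnt := independent_graphs_count c1 ns s24 (leq_trans (leq_mul (isT : 6 <= 8) (leqnn c)) c8) JJ.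
apply: leq_trans (leq_mul (subset_leq_card sub) ns) _.
rewrite mulnCA; apply: leq_trans (leq_mul (leqnn c) cnt) _.
rewrite mulnA (mulnC c) leq_mul2r leq_mul2l; apply/orP; right.
by move: c8; clear; lia.
Qed.

(** Origin of the constant 100: sparsity is required up to size k d^(2d+7) and is available up to
    n/L with L = d^(80d+42); the exponents add up to 82d+49, below 100d. *)
Lemma accepts_of_not_dense k (E : graphT n) : E \in regular_graphs n d ->
  E \notin dense_graphs n d -> 0 < k -> k * d ^ (100 * d) <= n -> accepts k E.
Proof.
move=> rE nd k0 hk; have [sE dE] := regularP _ _ rE.
apply: (@accepts_sparse n k E d sE) => [u|S cS]; first by rewrite -(dE u).
rewrite leqNgt; apply: contra nd => dS; rewrite inE rE; apply/existsP; exists S.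
rewrite dS andbT; apply: leq_trans hk.
set s1 := (30 * d + 16) * (2 * k) * d.+1 ^ d in cS.
have dd : 10 * d <= d ^ 2 by rewrite expnS expn1 leq_mul2r d10 orbT.
have ddd : 100 * d <= d ^ 3 by rewrite expnS (mulnC 100) leq_mul2l (@leq_exp2r 10 d 2) ?d10 ?orbT.
have e1 : (30 * d + 16) * (2 * k) <= d ^ 3 * (d * k).
  by apply: leq_mul; [move: d10 ddd; clear; lia | rewrite leq_mul2r (leq_trans _ d10) ?orbT].
have e2 : d.+1 ^ d <= d ^ (2 * d).
  by rewrite expnM leq_exp2r //; move: d10 dd; clear; lia.
have e3 : s1 <= k * d ^ (2 * d + 4).
  apply: leq_trans (leq_mul e1 e2) _; rewrite expnD [d ^ 4]expnSr.
  by apply: eq_leq; lia.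
have e4 : (2 * d + 1) * s1 <= k * d ^ (2 * d + 6).
  apply: leq_trans (leq_mul (_ : _ <= d ^ 2) e3) _; first by move: d10 dd; clear; lia.
  rewrite mulnCA -expnD; apply: eq_leq; congr (_ * _ ^ _); lia.
have e5 : (30 * d + 16) * (2 * k) <= k * d ^ (2 * d + 6).
  apply: leq_trans e1 _; rewrite mulnA -expnSr mulnC leq_mul2l leq_pexp2l ?orbT //.
  by clear; lia.
have e6 : #|S| <= k * d ^ (2 * d + 7).
  apply: leq_trans cS _; apply: leq_trans (leq_add e5 e4) _.
  rewrite addnn -mul2n mulnCA leq_mul2l [2 * d + 7]addnS expnS leq_mul2r.
  by rewrite (leq_trans _ d10) ?orbT.
apply: leq_trans (leq_mul e6 (leqnn _)) _.
rewrite -mulnA leq_mul2l -expnD leq_pexp2l ?orbT //.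
by move: d10; clear; lia.
Qed.

Lemma kbound_nat k : (INR k <= kbound 100 n d)%R -> k * d ^ (100 * d) <= n.
Proof.
move=> h; apply: le_INR_nat; rewrite INR_mul INR_exp.
have x0 := INR_gt0 d0.
have e : (INR d ^ (100 * d) = Rpower (INR d) (100 * INR d))%R.
  rewrite -Rpower_pow // INR_mul; congr (Rpower _ (_ * _)); rewrite /=; lra.
have p0 : (0 < Rpower (INR d) (100 * INR d))%R by apply: exp_pos.
rewrite e; move: h; rewrite /kbound Rpower_Ropp => h.
have := Rmult_le_compat_r _ _ _ (Rlt_le _ _ p0) h.
by rewrite Rmult_assoc Rinv_l; lra.
Qed.

Lemma good_event_of E : E \in regular_graphs n d -> E \notin dense_graphs n d ->
  E \notin low_chromatic -> good_event 100 d E.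
Proof.
move=> rE nd nl; split=> [|k k1 hk].
  apply: Rnot_le_lt => le; move: nl; rewrite inE rE /= => /negP; apply.
  exact/decPP.
exact: accepts_of_not_dense (kbound_nat hk).
Qed.

(** The failures have probability at most (L+9d)/n <= 10L/n. As L^2 <= n this is at most 10 over the
    square root of n, hence at most [eps]. A regular graph must exist for the quotient to be
    meaningful. *)
Lemma prob_good_event eps : ~~ odd (d * n) -> (0 < eps)%R -> (100 <= eps * eps * INR n)%R ->
  (1 - eps <= prob d (@good_event 100 n d))%R.
Proof.
move=> ev e0 en; set RG := #|regular_graphs n d|.
have [E0 rE0] : exists E, E \in regular_graphs n d.
  have ltd : d < n.
    by apply: leq_trans d5n; rewrite -{1}(expn1 d) ltn_exp2l // (leq_trans _ d10).
  by case: (n) ltd ev => // N ltd ev; apply: regular_exists.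
have RG0 : 0 < RG by apply/card_gt0P; exists E0.
pose G := [set E in regular_graphs n d | Defs.decP (good_event 100 d E)].
have le : RG <= #|G| + #|dense_graphs n d| + #|low_chromatic|.
  apply: leq_trans (_ : #|G :|: dense_graphs n d :|: low_chromatic| <= _).
    apply/subset_leq_card/subsetP => E rE; rewrite !in_setU.
    case nd: (E \in dense_graphs n d); first by rewrite orbT.
    case nl: (E \in low_chromatic); first by rewrite orbT.
    by rewrite !orbF inE rE; apply/decPP/good_event_of; rewrite ?nd ?nl.
  apply: leq_trans (leq_card_setU _ _) _; rewrite leq_add2r; exact: leq_card_setU.
have c1 := dense_graphs_count n d10; have c2 := low_chromatic_count.
rewrite -/L -/RG in c1 c2.
have dL : d <= L by rewrite -{1}(expn1 d) /L leq_pexp2l //; lia.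
have key : RG * n <= #|G| * n + 10 * L * RG.
  have := leq_mul le (leqnn n); rewrite !mulnDl => h; apply: leq_trans h _.
  rewrite -addnA leq_add2l; apply: leq_trans (leq_add c1 c2) _.
  have := leq_mul dL (leqnn RG); lia.
rewrite /prob -/G -/RG.
have rg := INR_gt0 RG0; have nn := INR_gt0 n0; have ll := INR_gt0 L0.
have keyR : (INR RG * INR n <= INR #|G| * INR n + 10 * INR L * INR RG)%R.
  have := leq_INR key; rewrite INR_add !INR_mul (_ : INR 10 = 10%R) //; rewrite /=; lra.
have LLR : (INR L * INR L <= INR n)%R by rewrite -INR_mul; apply: leq_INR.
have small : (10 * INR L <= eps * INR n)%R.
  apply: Rnot_lt_le => lt.
  have sq : ((eps * INR n) * (eps * INR n) < (10 * INR L) * (10 * INR L))%R.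
    apply: Rmult_le_0_lt_compat => //; apply: Rmult_le_pos; lra.
  have := Rmult_le_compat_r (INR n) _ _ (Rlt_le _ _ nn) en; lra.
apply: (Rmult_le_reg_r (INR RG)) => //.
rewrite /Rdiv Rmult_assoc Rinv_l; last by lra.
apply: (Rmult_le_reg_r (INR n)) => //.
have := Rmult_le_compat_r (INR RG) _ _ (Rlt_le _ _ rg) small; lra.
Qed.

End FixedDegree.

Open Scope R_scope.

Theorem mainTheorem1 :
  exists C : R, 0 < C /\
  forall d : nat -> nat,
    (exists N : nat, forall n : nat, (N <= n)%N ->
        [/\ (10 <= d n)%N, (6 * INR (d n) ^ 3 <= ln (INR n))
          & ~~ odd (d n * n)%N]) ->
    (forall eps : R, (0 < eps) ->
       exists N : nat, forall n : nat, (N <= n)%N ->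
         (1 - eps <= @prob n (d n) (@good_event C n (d n))))
    /\
    (exists N : nat, forall n : nat, (N <= n)%N ->
       forall k : nat, (1 <= k)%N -> (INR k <= kbound C n (d n)) ->
       ~ (forall E : graphT n, simpleb E ->
            (colorableb E 3 -> accepts k E) /\
            ((chi_threshold (d n) < INR (chromatic_number E)) ->
               ~~ accepts k E))).
Proof.
exists 100; split; first by lra.
move=> d [N0 hyp].
have likely eps : 0 < eps -> exists N : nat, forall n : nat, (N <= n)%N ->
    1 - eps <= @prob n (d n) (@good_event 100 n (d n)).
  move=> e0; have [M hM] := INR_unbounded (100 / (eps * eps)).
  exists (maxn (maxn N0 M) 1) => n; rewrite !geq_max => /andP[/andP[nN nM] n1].
  have [d10 dl ev] := hyp n nN.
  apply: prob_good_event => //; first by rewrite -expnD addnn -mul2n; apply: pow_le_of_ln.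
  have e2 : 0 < eps * eps by apply: Rmult_lt_0_compat.
  have := leq_INR nM => h.
  have -> : 100 = eps * eps * (100 / (eps * eps)) by field; lra.
  by apply: Rmult_le_compat_l; lra.
split; first exact: likely.
(* Positive probability suffices: one good graph exceeds the threshold and is accepted
   nevertheless. *)
have [|N hN] := likely (1 / 2); first by lra.
exists N => n nN k k1 hk H; have := hN n nN; rewrite /prob.
set G := [set E in _ | _]; have [-> |[E]] := set_0Vmem G.
  by rewrite cards0 /= /Rdiv Rmult_0_l; lra.
rewrite inE => /andP[/regularP[sE _] /decPP[chi acc]] _.
by have [_ /(_ chi)] := H E sE; rewrite acc.
Qed.
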